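(* The group $\mathrm{SCont}_\vee(S^{1|1};\mathcal A)$ of surplace contactomorphisms coincides with the surplace group $\mathrm{Cont}_\vee(S^{1|1};\mathcal A)$ corresponding to the Lie superalgebra $\mathfrak{cont}(S^{1|1})$. (That is, the natural homomorphism $\mathrm{Cont}_\vee(S^{1|1};\mathcal A)\to\mathrm{SCont}_\vee(S^{1|1};\mathcal A)$ is bijective.)
   Context: $\mathcal A$ is the complex Grassmann algebra with generators $\mathfrak a_1,\mathfrak a_2,\dots$ ($\mathfrak a_k\mathfrak a_l=-\mathfrak a_l\mathfrak a_k$, $\mathfrak a_k^2=0$; finite linear combinations of monomials), with even and odd parts $\mathcal A_{\bar0},\mathcal A_{\bar1}$; a monomial is $s\,\mathfrak a_{j_1}\cdots\mathfrak a_{j_m}$, $s\in\mathbb C$, with distinct $j_l$, of degree $m$; the subscript $\downarrow$ means putting all $\mathfrak a_j=0$. $S^{1|1}$ is the circle $\phi\in\mathbb R/2\pi\mathbb Z$ with an odd coordinate $\theta$, $\theta^2=0$; $\theta$ is assumed to commute with all $\mathfrak a_j$. $C^\infty[S^{1|1};\mathcal A]$ consists of $f(\phi)+g(\phi)\theta$ with $f,g\in C^\infty(S^1)\otimes\mathcal A$. A diffeomorphism of $S^{1|1}$ is a substitution $\phi\mapsto Q+q\theta$, $\theta\mapsto R\theta+r$, where $Q,R$ are $\mathcal A_{\bar0}$-valued and $q,r$ are $\mathcal A_{\bar1}$-valued smooth functions of $\phi$, $Q_\downarrow,R_\downarrow$ are real, $\partial_\phi Q_\downarrow\ne0$, $R_\downarrow\ne0$;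 substitution into functions is by Taylor expansion in nilpotent parts. It is contact if it sends $\Omega=d\phi+\theta\,d\theta$ to an expression $h(\phi,\theta;\mathfrak a)\cdot\Omega$. $\mathrm{SCont}_\vee(S^{1|1};\mathcal A)$ is the group of contact diffeomorphisms with $Q_\downarrow=\phi$, $R_\downarrow=1$. $\mathfrak{cont}(S^{1|1})$ is the Lie superalgebra of vector fields with even part $\{L(a)=a\partial_\phi+\frac12a'\theta\partial_\theta\}$ and odd part $\{M(b)=b\theta\partial_\phi-b\partial_\theta\}$, with $a,b$ smooth complex-valued functions on $S^1$. For a Lie superalgebra $\mathfrak g=\mathfrak g_{\bar0}\oplus\mathfrak g_{\bar1}$ with universal enveloping algebra $U(\mathfrak g)$, consider $U(\mathfrak g)\otimes\mathcal A$, where elements of $\mathcal A$ and elements of $U(\mathfrak g)$ are assumed to commute. The surplace group of $\mathfrak g$ is the subgroup of the multiplicative group of $U(\mathfrak g)\otimes\mathcal A$ generated by all $1+\lambda X$ ($X\in\mathfrak g_{\bar0}$, $\lambda$ a monomial of even positive degree) and $1+\mu Y$ ($Y\in\mathfrak g_{\bar1}$, $\mu$ a monomial of odd degree). $\mathrm{Cont}_\vee(S^{1|1};\mathcal A)$ is the surplace group of $\mathfrak g=\mathfrak{cont}(S^{1|1})$. In the natural homomorphism $1+\lambda L(a)$ corresponds to the diffeomorphism $(\phi,\theta)\mapsto(\phi+\lambda a,\ \theta+\frac12\lambda a'\theta)$ and $1+\mu M(b)$ corresponds to $(\phi,\theta)\mapsto(\phi+\mu b\,\theta,\ \theta-\mu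 b)$. *)

(* Defs.v *)
From HB Require Import structures.
From mathcomp Require Import all_boot all_order all_algebra.
From mathcomp Require Import generic_quotient ring_quotient.
From mathcomp Require Import finmap monalg.
From mathcomp Require Import complex.
From mathcomp Require Import all_classical all_reals all_analysis.
From mathcomp Require Import ring zify.
Set Implicit Arguments.
Unset Strict Implicit.
Unset Printing Implicit Defensive.
Import Order.TTheory GRing.Theory Num.Theory numFieldNormedType.Exports.
Local Open Scope ring_scope.

Section Smooth.
Variable R : realType.
Implicit Types f g : R -> R.

Definition smooth f : Prop := forall n x, derivable (derive1n n f) x 1.

Fixpoint ntimes_derivable n f : Prop :=
  if n is m.+1 then (forall x, derivable f x 1) /\ ntimes_derivable m (derive1 f)
  else True.

Lemma smoothP f : smooth f <-> forall n, ntimes_derivable n f.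
Proof.
split=> [sf n|nf n x].
  elim: n f sf => //= n ih f sf; split=> [x|]; first exact: (sf 0%N).
  by apply: ih => m x; rewrite -derive1Sn; apply: sf.
elim: n f nf => [|n ih] f nf; first exact: (nf 1%N).1.
by rewrite derive1Sn; apply: ih => m; apply: (nf m.+1).2.
Qed.

Lemma ntimes_derivableW n f : ntimes_derivable n.+1 f -> ntimes_derivable n f.
Proof. by elim: n f => //= n ih f [? h]; split => //; apply: ih. Qed.

Lemma derive1D_fun f g : (forall x, derivable f x 1) ->
  (forall x, derivable g x 1) -> derive1 (f + g) = derive1 f + derive1 g.
Proof.
move=> df dg; apply/funext => x.
by rewrite derive1E deriveD //= fctE !derive1E.
Qed.

Lemma derive1M_fun f g : (forall x, derivable f x 1) ->
  (forall x, derivable g x 1) -> derive1 (f * g) = derive1 f * g + f * derive1 g.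
Proof.
move=> df dg; apply/funext => x.
rewrite derive1E deriveM //= !fctE !derive1E addrC; congr (_ + _).
exact: mulrC.
Qed.

Lemma ntimes_derivableD n f g : ntimes_derivable n f -> ntimes_derivable n g ->
  ntimes_derivable n (f + g).
Proof.
elim: n f g => //= n ih f g [df nf] [dg ng].
split=> [x|]; first exact: derivableD.
by rewrite derive1D_fun //; apply: ih.
Qed.

Lemma ntimes_derivableM n f g : ntimes_derivable n f -> ntimes_derivable n g ->
  ntimes_derivable n (f * g).
Proof.
elim: n f g => // n ih f g nf ng; case: (nf) (ng) => [df nf'] [dg ng'] /=.
split=> [x|]; first exact: derivableM.
rewrite derive1M_fun //.
by apply: ntimes_derivableD; apply: ih => //; apply: ntimes_derivableW.
Qed.

Lemma smoothD f g : smooth f -> smooth g -> smooth (f + g).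
Proof.
by move=> /smoothP sf /smoothP sg; apply/smoothP => n; apply: ntimes_derivableD.
Qed.

Lemma smoothM f g : smooth f -> smooth g -> smooth (f * g).
Proof.
by move=> /smoothP sf /smoothP sg; apply/smoothP => n; apply: ntimes_derivableM.
Qed.

Lemma smooth_cst (k : R) : smooth (cst k).
Proof.
apply/smoothP => n; elim: n k => //= n ih k; split=> [x|].
  exact: derivable_cst.
rewrite (_ : derive1 _ = cst 0); first exact: ih.
by apply/funext => x; rewrite derive1_cst.
Qed.

Lemma smoothN f : smooth f -> smooth (- f).
Proof.
move=> sf; have := smoothM (@smooth_cst (-1)) sf; congr smooth.
by apply/funext => x; rewrite !fctE mulN1r.
Qed.

Lemma smooth_derive1 f : smooth f -> smooth (derive1 f).
Proof. by move=> sf n x; rewrite -derive1Sn; apply: sf. Qed.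

End Smooth.

Section CircleFunctions.
Variable R : realType.
Implicit Types f g : R -> R[i].

(* C^oo(S^1): smooth 2pi-periodic functions R -> R[i].  R[i] carries no        *)
(* normed R-module structure here, so smoothness is that of the real and       *)
(* imaginary parts.                                                            *)
Definition circle_smooth : {pred R -> R[i]} := fun f =>
  `[< [/\ smooth (fun x => complex.Re (f x)), smooth (fun x => complex.Im (f x)) &
          forall x, f (x + pi *+ 2) = f x] >].

Lemma circle_smooth_cst k : (fun=> k) \in circle_smooth.
Proof. by apply/asboolP; split => //; apply: smooth_cst. Qed.

Lemma circle_smooth_sub : {in circle_smooth &, forall f g, f - g \in circle_smooth}.
Proof.
move=> f g /asboolP[rf jf pf] /asboolP[rg jg pg]; apply/asboolP; split.
- rewrite (_ : (fun x => _) = (fun x => complex.Re (f x)) - (fun x => complex.Re (g x))).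
    exact: smoothD rf (smoothN rg).
  by apply/funext => x; rewrite !fctE raddfB.
- rewrite (_ : (fun x => _) = (fun x => complex.Im (f x)) - (fun x => complex.Im (g x))).
    exact: smoothD jf (smoothN jg).
  by apply/funext => x; rewrite !fctE raddfB.
- by move=> x; rewrite !fctE pf pg.
Qed.

Lemma circle_smooth_mul : {in circle_smooth &, forall f g, f * g \in circle_smooth}.
Proof.
move=> f g /asboolP[rf jf pf] /asboolP[rg jg pg]; apply/asboolP; split.
- rewrite (_ : (fun x => _) = (fun x => complex.Re (f x)) * (fun x => complex.Re (g x))
      - (fun x => complex.Im (f x)) * (fun x => complex.Im (g x))).
    exact: smoothD (smoothM rf rg) (smoothN (smoothM jf jg)).
  by apply/funext => x; rewrite !fctE; case: (f x) (g x) => ? ? [].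
- rewrite (_ : (fun x => _) = (fun x => complex.Re (f x)) * (fun x => complex.Im (g x))
      + (fun x => complex.Im (f x)) * (fun x => complex.Re (g x))).
    exact: smoothD (smoothM rf jg) (smoothM jf rg).
  by apply/funext => x; rewrite !fctE; case: (f x) (g x) => ? ? [].
- by move=> x; rewrite !fctE pf pg.
Qed.

Lemma circle_smooth_subring : subring_closed circle_smooth.
Proof.
split; [exact: circle_smooth_cst|exact: circle_smooth_sub|exact: circle_smooth_mul].
Qed.

Lemma circle_smooth_scale : GRing.scaler_closed circle_smooth.
Proof.
move=> k f sf; rewrite (_ : k *: f = (fun=> k) * f) //.
by apply: circle_smooth_mul => //; apply: circle_smooth_cst.
Qed.

HB.instance Definition _ := GRing.isSubringClosed.Build _ circle_smooth
  circle_smooth_subring.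
HB.instance Definition _ := GRing.isScaleClosed.Build _ _ circle_smooth
  circle_smooth_scale.

Record cinf : Type := CInf { cinf_fun :> R -> R[i]; _ : cinf_fun \in circle_smooth }.

HB.instance Definition _ := [isSub for cinf_fun].
HB.instance Definition _ := [Choice of cinf by <:].
HB.instance Definition _ := [SubChoice_isSubComNzRing of cinf by <:].
HB.instance Definition _ := [SubZmodule_isSubLmodule of cinf by <:].

Lemma cinfP (f g : cinf) : cinf_fun f =1 cinf_fun g -> f = g.
Proof. by move=> fg; apply/val_inj/funext. Qed.

Lemma cinf_funD (f g : cinf) x : cinf_fun (f + g) x = cinf_fun f x + cinf_fun g x.
Proof. by []. Qed.
Lemma cinf_funM (f g : cinf) x : cinf_fun (f * g) x = cinf_fun f x * cinf_fun g x.
Proof. by []. Qed.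
Lemma cinf_funZ k (f : cinf) x : cinf_fun (k *: f) x = k * cinf_fun f x.
Proof. by []. Qed.

Lemma cinf_scaleAl (k : R[i]) (f g : cinf) : k *: (f * g) = k *: f * g.
Proof.
by apply: cinfP => x; rewrite cinf_funZ !cinf_funM cinf_funZ; apply: mulrA.
Qed.
HB.instance Definition _ := GRing.Lmodule_isLalgebra.Build R[i] cinf cinf_scaleAl.
HB.instance Definition _ := GRing.Lalgebra_isComAlgebra.Build R[i] cinf.

End CircleFunctions.

Section CircleFunctions.
Variable R : realType.
Implicit Types f g : R -> R[i].
Local Notation cinf := (cinf R).
Local Notation circle_smooth := (@circle_smooth R).
Definition deriv_fun (f : R -> R[i]) : R -> R[i] := fun x =>
  (derive1 (fun y => complex.Re (f y)) x +i* derive1 (fun y => complex.Im (f y)) x)%C.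

Lemma derive1_periodic (h : R -> R) (p : R) : (forall x, h (x + p) = h x) ->
  forall x, derive1 h (x + p) = derive1 h x.
Proof.
move=> hp x; rewrite /derive1.
suff -> : (fun k => k^-1 *: (h (k + (x + p)) - h (x + p))) =
          (fun k => k^-1 *: (h (k + x) - h x)) by [].
by apply/funext => k; rewrite addrA !hp.
Qed.

Lemma deriv_fun_circle f : f \in circle_smooth -> deriv_fun f \in circle_smooth.
Proof.
move=> /asboolP[rf jf pf]; apply/asboolP; split; rewrite /=.
- exact: smooth_derive1 rf.
- exact: smooth_derive1 jf.
- by move=> x; rewrite /deriv_fun !derive1_periodic // => y; rewrite pf.
Qed.

End CircleFunctions.

HB.lock
Definition cderiv (R : realType) (f : cinf R) : cinf R :=
  CInf (deriv_fun_circle (valP f)).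

Section CircleDerivation.
Variable R : realType.
Local Notation cinf := (cinf R).

Lemma cderivE (f : cinf) : cinf_fun (cderiv f) = deriv_fun (cinf_fun f).
Proof. by rewrite unlock. Qed.


Definition cinf_re (f : cinf) : R -> R := fun x => complex.Re (cinf_fun f x).
Definition cinf_im (f : cinf) : R -> R := fun x => complex.Im (cinf_fun f x).

Lemma cinf_reimP (f g : cinf) :
  cinf_re f = cinf_re g -> cinf_im f = cinf_im g -> f = g.
Proof.
move=> re im; apply: cinfP => x; apply/eqP; rewrite eq_complex.
by rewrite -![complex.Re _]/(cinf_re _ x) -![complex.Im _]/(cinf_im _ x) re im !eqxx.
Qed.

Lemma derivable_re (f : cinf) x : derivable (cinf_re f) x 1.
Proof. by have /asboolP[rf _ _] := valP f; apply: (rf 0%N). Qed.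
Lemma derivable_im (f : cinf) x : derivable (cinf_im f) x 1.
Proof. by have /asboolP[_ jf _] := valP f; apply: (jf 0%N). Qed.

Lemma cinf_reD (f : cinf) (g : cinf) : cinf_re (f + g) = cinf_re f + cinf_re g.
Proof. by apply/funext => x; rewrite /cinf_re cinf_funD raddfD. Qed.
Lemma cinf_imD (f : cinf) (g : cinf) : cinf_im (f + g) = cinf_im f + cinf_im g.
Proof. by apply/funext => x; rewrite /cinf_im cinf_funD raddfD. Qed.
Lemma cinf_reM (f : cinf) (g : cinf) :
  cinf_re (f * g) = cinf_re f * cinf_re g - cinf_im f * cinf_im g.
Proof.
apply/funext => x; rewrite !fctE /cinf_re /cinf_im cinf_funM.
by case: (cinf_fun f x) (cinf_fun g x) => ? ? [].
Qed.
Lemma cinf_imM (f : cinf) (g : cinf) :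
  cinf_im (f * g) = cinf_re f * cinf_im g + cinf_im f * cinf_re g.
Proof.
apply/funext => x; rewrite !fctE /cinf_re /cinf_im cinf_funM.
by case: (cinf_fun f x) (cinf_fun g x) => ? ? [].
Qed.
Lemma cinf_re_deriv (f : cinf) : cinf_re (cderiv f) = derive1 (cinf_re f).
Proof. by rewrite /cinf_re cderivE. Qed.
Lemma cinf_im_deriv (f : cinf) : cinf_im (cderiv f) = derive1 (cinf_im f).
Proof. by rewrite /cinf_im cderivE. Qed.

Lemma cderivD : {morph @cderiv R : f g / f + g}.
Proof.
move=> f g; apply: cinf_reimP.
  rewrite cinf_re_deriv !cinf_reD !cinf_re_deriv derive1D_fun //;
  exact: derivable_re.
rewrite cinf_im_deriv !cinf_imD !cinf_im_deriv derive1D_fun //;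
exact: derivable_im.
Qed.

Lemma derive1B_fun (a b : R -> R) : (forall x, derivable a x 1) ->
  (forall x, derivable b x 1) -> derive1 (a - b) = derive1 a - derive1 b.
Proof.
move=> df dg; apply/funext => x.
have -> : (derive1 a - derive1 b) x = derive1 a x - derive1 b x by [].
by rewrite (derive1E a) (derive1E b) (derive1E (a - b)); apply: deriveB.
Qed.

Lemma cderivM (f : cinf) (g : cinf) : cderiv (f * g) = cderiv f * g + f * cderiv g.
Proof.
have dr := @derivable_re; have di := @derivable_im.
apply: cinf_reimP.
  rewrite cinf_re_deriv cinf_reD !cinf_reM !cinf_re_deriv !cinf_im_deriv.
  rewrite derive1B_fun; [|by move=> x; apply: derivableM..].
  by rewrite !derive1M_fun // opprD addrACA.
rewrite cinf_im_deriv cinf_imD !cinf_imM !cinf_re_deriv !cinf_im_deriv.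
rewrite derive1D_fun; [|by move=> x; apply: derivableM..].
by rewrite !derive1M_fun // addrACA.
Qed.

Lemma cderiv_const (k : R[i]) : cderiv k%:A = 0.
Proof.
apply: cinf_reimP; apply/funext => x.
  rewrite cinf_re_deriv (_ : cinf_re _ = cst (complex.Re k)) ?derive1_cst //.
  by apply/funext => y; rewrite /cinf_re cinf_funZ mulr1.
rewrite cinf_im_deriv (_ : cinf_im _ = cst (complex.Im k)) ?derive1_cst //.
by apply/funext => y; rewrite /cinf_im cinf_funZ mulr1.
Qed.

Lemma cderivZ k (f : cinf) : cderiv (k *: f) = k *: cderiv f.
Proof. by rewrite -mulr_algl cderivM cderiv_const mul0r add0r mulr_algl. Qed.
End CircleDerivation.

(* grassmann S is S (x) A, where A is the complex Grassmann algebra on a_0,     *)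
(* a_1, ... and the elements of A commute with those of the (possibly          *)
(* noncommutative) algebra S.  A is free on the a_I = a_{i_1} ... a_{i_m} for  *)
(* finite I = {i_1 < ... < i_m}, so an element is a finitely supported family  *)
(* of coefficients indexed by I, and a_I a_J is 0 when I meets J and           *)
(* (-1)^(ninv I J) a_{I u J} otherwise.                                        *)
Definition ninv (I J : {fset nat}) : nat :=
  (\sum_(i <- I) \sum_(j <- J) (j < i)%N)%N.

Definition grassmann (S : pzRingType) := malg {fset nat} S.
HB.instance Definition _ (S : pzRingType) := GRing.Zmodule.copy (grassmann S) (malg {fset nat} S).

Definition gmon (S : pzRingType) (I : {fset nat}) (c : S) : grassmann S :=
  << c *g I >>.

Definition gmulU (S : pzRingType) (I J : {fset nat}) (a b : S) : grassmann S :=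
  if [disjoint I & J]%fset
  then gmon (I `|` J)%fset ((-1) ^+ ninv I J * (a * b)) else 0.

HB.lock
Definition gmul (S : pzRingType) (x y : grassmann S) : grassmann S :=
  \sum_(I <- msupp x) \sum_(J <- msupp y) gmulU I J x@_I y@_J.

Section Grassmann.
Variable S : pzRingType.
Implicit Types (x y z : grassmann S) (I J K : {fset nat}) (a b c : S).
Local Notation gmul := (@gmul S).

Lemma gmonD I : {morph @gmon S I : a b / a + b}. Proof. exact: monalgUD. Qed.
Lemma gmon0 I : gmon I 0 = 0 :> grassmann S. Proof. exact: monalgU0. Qed.

Lemma gmulU0l I J b : gmulU I J 0 b = 0.
Proof. by rewrite /gmulU mul0r mulr0 gmon0 if_same. Qed.
Lemma gmulU0r I J a : gmulU I J a 0 = 0.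
Proof. by rewrite /gmulU mulr0 mulr0 gmon0 if_same. Qed.
Lemma gmulUDl I J a a' b : gmulU I J (a + a') b = gmulU I J a b + gmulU I J a' b.
Proof.
rewrite /gmulU; case: (boolP [disjoint I & J]%fset) => _; last by rewrite addr0.
by rewrite -gmonD -mulrDr -mulrDl.
Qed.
Lemma gmulUDr I J a b b' : gmulU I J a (b + b') = gmulU I J a b + gmulU I J a b'.
Proof.
rewrite /gmulU; case: (boolP [disjoint I & J]%fset) => _; last by rewrite addr0.
by rewrite -gmonD -!mulrDr.
Qed.

Lemma big_msuppw (T : zmodType) (A : {fset {fset nat}}) x
    (F : {fset nat} -> S -> T) :
  (forall I, F I 0 = 0) -> (msupp x `<=` A)%fset ->
  \sum_(I <- msupp x) F I x@_I = \sum_(I <- A) F I x@_I.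
Proof.
move=> F0 sA; apply: big_fset_incl => // I _; rewrite -mcoeff_eq0 => /eqP ->.
exact: F0.
Qed.

Lemma gmulw (A B : {fset {fset nat}}) x y :
  (msupp x `<=` A)%fset -> (msupp y `<=` B)%fset ->
  gmul x y = \sum_(I <- A) \sum_(J <- B) gmulU I J x@_I y@_J.
Proof.
move=> sA sB; rewrite unlock (big_msuppw (F := fun I a =>
  \sum_(J <- msupp y) gmulU I J a y@_J) _ sA); last first.
  by move=> I; rewrite big1 // => J _; rewrite gmulU0l.
apply: eq_bigr => I _.
by rewrite (big_msuppw (F := fun J b => gmulU I J x@_I b) _ sB) // => J; rewrite gmulU0r.
Qed.

Lemma gmulDl : left_distributive gmul +%R.
Proof.
move=> x y z; pose A := (msupp x `|` msupp y)%fset.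
rewrite (@gmulw A (msupp z)) ?msuppD_le // (@gmulw A (msupp z) x) ?fsubsetUl //.
rewrite (@gmulw A (msupp z) y) ?fsubsetUr // -big_split; apply: eq_bigr => I _ /=.
by rewrite -big_split; apply: eq_bigr => J _ /=; rewrite mcoeffD gmulUDl.
Qed.

Lemma gmulDr : right_distributive gmul +%R.
Proof.
move=> z x y; pose A := (msupp x `|` msupp y)%fset.
rewrite (@gmulw (msupp z) A) ?msuppD_le // (@gmulw (msupp z) A _ x) ?fsubsetUl //.
rewrite (@gmulw (msupp z) A _ y) ?fsubsetUr // -big_split; apply: eq_bigr => I _ /=.
by rewrite -big_split; apply: eq_bigr => J _ /=; rewrite mcoeffD gmulUDr.
Qed.

Lemma gmul0 x : gmul 0 x = 0.
Proof. by rewrite unlock msupp0 big_seq_fset0. Qed.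
Lemma gmulx0 x : gmul x 0 = 0.
Proof. by rewrite unlock big1 // => I _; rewrite msupp0 big_seq_fset0. Qed.

Lemma gmul_suml (T : Type) (r : seq T) (F : T -> grassmann S) y :
  gmul (\sum_(i <- r) F i) y = \sum_(i <- r) gmul (F i) y.
Proof. by apply: (big_morph (gmul^~ y)) => [u v|]; rewrite ?gmulDl ?gmul0. Qed.
Lemma gmul_sumr (T : Type) (r : seq T) (F : T -> grassmann S) y :
  gmul y (\sum_(i <- r) F i) = \sum_(i <- r) gmul y (F i).
Proof. by apply: (big_morph (gmul y)) => [u v|]; rewrite ?gmulDr ?gmulx0. Qed.

Lemma gmul_mon I J a b : gmul (gmon I a) (gmon J b) = gmulU I J a b.
Proof.
rewrite (@gmulw [fset I]%fset [fset J]%fset) ?msuppU_le //.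
by rewrite !big_seq_fset1 !mcoeffUU.
Qed.

Lemma grassmannE x : x = \sum_(I <- msupp x) gmon I x@_I.
Proof. exact: monalgE. Qed.

Lemma big_fsetU_disj (F : nat -> nat) I J : [disjoint I & J]%fset ->
  (\sum_(i <- (I `|` J)%fset) F i = \sum_(i <- I) F i + \sum_(i <- J) F i)%N.
Proof.
move=> /fdisjointP dIJ; rewrite (big_fsetID _ (mem I)) /=; congr (_ + _)%N.
  by apply: eq_fbigl => i; rewrite !inE /=; case: (i \in I); rewrite ?andbF.
apply: eq_fbigl => i; rewrite !inE /=.
by case: (boolP (i \in I)) => [/dIJ/negbTE->|]; rewrite ?andbF ?andbT.
Qed.

Lemma ninvUl I J K : [disjoint I & J]%fset ->
  ninv (I `|` J)%fset K = (ninv I K + ninv J K)%N.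
Proof. by move=> dIJ; rewrite /ninv big_fsetU_disj. Qed.

Lemma ninvUr I J K : [disjoint J & K]%fset ->
  ninv I (J `|` K)%fset = (ninv I J + ninv I K)%N.
Proof.
move=> dJK; rewrite /ninv -big_split; apply: eq_bigr => i _ /=.
by rewrite big_fsetU_disj.
Qed.

Lemma grassmann_ind (P : grassmann S -> Prop) :
  P 0 -> (forall x y, P x -> P y -> P (x + y)) ->
  (forall I a, P (gmon I a)) -> forall x, P x.
Proof.
move=> P0 PD Pm x; rewrite (grassmannE x).
by apply: (big_ind P) => // I _; apply: Pm.
Qed.

Lemma gmulUA I J K a b c :
  gmul (gmon I a) (gmul (gmon J b) (gmon K c)) =
  gmul (gmul (gmon I a) (gmon J b)) (gmon K c).
Proof.
rewrite !gmul_mon /gmulU.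
case: (boolP [disjoint J & K]%fset) => dJK; last first.
  rewrite gmulx0; case: (boolP [disjoint I & J]%fset) => dIJ; last by rewrite gmul0.
  by rewrite gmul_mon /gmulU fdisjointUX (negbTE dJK) andbF.
rewrite gmul_mon /gmulU fdisjointXU.
case: (boolP [disjoint I & J]%fset) => dIJ /=; last by rewrite gmul0.
rewrite gmul_mon /gmulU fdisjointUX dJK andbT.
case: (boolP [disjoint I & K]%fset) => // dIK.
rewrite fsetUA; congr gmon; rewrite ninvUl // ninvUr // !exprD.
have sC n u : u * (-1) ^+ n = (-1) ^+ n * u :> S by exact: commr_sign.
rewrite !mulrA sC !mulrA -!exprD -!mulrA; congr (_ * _).
by congr (_ ^+ _); lia.
Qed.

Lemma gmulA : associative gmul.
Proof.
move=> x y z.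
elim/grassmann_ind: x => [|x x' Hx Hx'|I a]; first by rewrite !gmul0.
  by rewrite !gmulDl Hx Hx'.
elim/grassmann_ind: y => [|y y' Hy Hy'|J b]; first by rewrite gmul0 gmulx0 gmul0.
  by rewrite (gmulDl y) !(gmulDr (gmon I a)) Hy Hy' gmulDl.
elim/grassmann_ind: z => [|z z' Hz Hz'|K c]; first by rewrite !gmulx0.
  by rewrite (gmulDr (gmon J b)) !(gmulDr (gmon I a)) Hz Hz' gmulDr.
exact: gmulUA.
Qed.

Lemma ninv0l I : ninv fset0 I = 0%N.
Proof. by rewrite /ninv big_seq_fset0. Qed.
Lemma ninv0r I : ninv I fset0 = 0%N.
Proof. by rewrite /ninv big1 // => i _; rewrite big_seq_fset0. Qed.

Lemma gmul1x : left_id (gmon fset0 1) gmul.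
Proof.
move=> x; elim/grassmann_ind: x => [|x y Hx Hy|I a]; first by rewrite gmulx0.
  by rewrite gmulDr Hx Hy.
by rewrite gmul_mon /gmulU fdisjoint0X ninv0l !mul1r fset0U.
Qed.
Lemma gmulx1 : right_id (gmon fset0 1) gmul.
Proof.
move=> x; elim/grassmann_ind: x => [|x y Hx Hy|I a]; first by rewrite gmul0.
  by rewrite gmulDl Hx Hy.
by rewrite gmul_mon /gmulU fdisjointX0 ninv0r mul1r mulr1 fsetU0.
Qed.

HB.instance Definition _ := GRing.Zmodule_isPzRing.Build (grassmann S)
  gmulA gmul1x gmulx1 gmulDl gmulDr.
End Grassmann.

(* The product of x with the monomial s a_I, of degree #|I|.                   *)
Definition mono (K : pzRingType) (S : lalgType K) (s : K) (I : {fset nat})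
  (x : S) : grassmann S := gmon I (s *: x).


(* The bracket is given on homogeneous elements; [u, x] = - [x, u] for x even  *)
(* and u odd.                                                                  *)
Record lieSuperalgebra (K : numFieldType) := LieSuperalgebra {
  lie0 : lmodType K;
  lie1 : lmodType K;
  br00 : lie0 -> lie0 -> lie0;
  br01 : lie0 -> lie1 -> lie1;
  br11 : lie1 -> lie1 -> lie0;
  br00_linear : forall x, linear (br00 x);
  br01_linearl : forall v, linear (br01^~ v);
  br01_linearr : forall x, linear (br01 x);
  br11_linear : forall u, linear (br11 u);
  br00_anti : forall x y, br00 x y = - br00 y x;
  br11_sym : forall u v, br11 u v = br11 v u;
  jacobi000 : forall x y z,
    br00 x (br00 y z) = br00 (br00 x y) z + br00 y (br00 x z);
  jacobi001 : forall x y w,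
    br01 x (br01 y w) = br01 (br00 x y) w + br01 y (br01 x w);
  jacobi011 : forall x u v,
    br00 x (br11 u v) = br11 (br01 x u) v + br11 u (br01 x v);
  jacobi111 : forall u v w,
    br01 (br11 u v) w + br01 (br11 v w) u + br01 (br11 w u) v = 0
}.

Section AugmentationAux.
Variables (K : numFieldType) (T : lalgType K) (f : T -> K).
Let subr_morph := forall r s, f (r - s) = f r - f s.
Let addr_morph := forall r s, f (r + s) = f r + f s.
Let scaler_morph := forall k r, f (k *: r) = k * f r.
Let mulr_morph := forall r s, f (r * s) = f r * f s.

Lemma aug_lin (fB : subr_morph) (fD : addr_morph) (fZ : scaler_morph) k a b c :
  f a = 0 -> f b = 0 -> f c = 0 -> f (c - (k *: a + b)) = 0.
Proof. by move=> ha hb hc; rewrite fB fD fZ ha hb hc mulr0 addr0 subr0. Qed.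

Lemma aug_comm (fB : subr_morph) (fM : mulr_morph) a b c :
  f a = 0 -> f b = 0 -> f c = 0 -> f (a * b - b * a - c) = 0.
Proof. by move=> ha hb hc; rewrite !fB !fM ha hb hc mulr0 !subr0. Qed.

Lemma aug_acomm (fB : subr_morph) (fD : addr_morph) (fM : mulr_morph) a b c :
  f a = 0 -> f b = 0 -> f c = 0 -> f (a * b + b * a - c) = 0.
Proof. by move=> ha hb hc; rewrite fB fD !fM ha hb hc mulr0 addr0 subr0. Qed.
End AugmentationAux.

(* U(g) is the quotient of the free associative algebra on the homogeneous     *)
(* elements of g by the two-sided ideal generated by the linear relations of   *)
(* g and by the x y -+ y x - [x, y], with x y + y x for x and y both odd.      *)
Section Enveloping.
Local Open Scope quotient_scope.
Variables (K : numFieldType) (g : lieSuperalgebra K).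

Local Notation tensor_alg := {malg K[{fmonom (lie0 g + lie1 g)%type}]}.
Definition tgen0 (x : lie0 g) : tensor_alg := << fmu (inl x) >>.
Definition tgen1 (u : lie1 g) : tensor_alg := << fmu (inr u) >>.

Inductive env_rel : tensor_alg -> Prop :=
| env_lin0 k x y : env_rel (tgen0 (k *: x + y) - (k *: tgen0 x + tgen0 y))
| env_lin1 k u v : env_rel (tgen1 (k *: u + v) - (k *: tgen1 u + tgen1 v))
| env_br00 x y :
    env_rel (tgen0 x * tgen0 y - tgen0 y * tgen0 x - tgen0 (br00 x y))
| env_br01 x u :
    env_rel (tgen0 x * tgen1 u - tgen1 u * tgen0 x - tgen1 (br01 x u))
| env_br11 u v :
    env_rel (tgen1 u * tgen1 v + tgen1 v * tgen1 u - tgen0 (br11 u v)).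

Inductive env_ideal : tensor_alg -> Prop :=
| env_ideal_rel r : env_rel r -> env_ideal r
| env_ideal0 : env_ideal 0
| env_idealD r s : env_ideal r -> env_ideal s -> env_ideal (r + s)
| env_idealMl t r : env_ideal r -> env_ideal (t * r)
| env_idealMr t r : env_ideal r -> env_ideal (r * t).

Definition env_ideal_pred : {pred tensor_alg} := fun t => `[< env_ideal t >].

Lemma env_ideal_zmod : zmod_closed env_ideal_pred.
Proof.
split=> [|r s]; first exact/asboolP/env_ideal0.
move=> /asboolP hr /asboolP hs; apply/asboolP/env_idealD => //.
by rewrite -mulN1r; apply: env_idealMl.
Qed.

HB.instance Definition _ := GRing.isZmodClosed.Build tensor_alg env_ideal_pred
  env_ideal_zmod.

Definition env_ideal_zmodClosed : zmodClosed tensor_alg := env_ideal_pred.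
Definition env : Type := Quotient.quot env_ideal_zmodClosed.

HB.instance Definition _ := GRing.Zmodule.on env.

Fact env_key : unit. Proof. by []. Qed.
Definition env_pi : tensor_alg -> env :=
  locked_with env_key (\pi_(Quotient.quot env_ideal_zmodClosed)).
Definition env_repr : env -> tensor_alg :=
  fun x => repr (x : Quotient.quot env_ideal_zmodClosed).

Lemma env_reprK x : env_pi (env_repr x) = x.
Proof. by rewrite /env_pi unlock; apply: reprK. Qed.

Lemma env_piP t t' : env_pi t = env_pi t' <-> env_ideal (t - t').
Proof.
rewrite /env_pi unlock; split => [/eqP|h].
  by rewrite -Quotient.idealrBE => /asboolP.
by apply/eqP; rewrite -Quotient.idealrBE; apply/asboolP.
Qed.

Lemma env_ind (P : env -> Prop) : (forall t, P (env_pi t)) -> forall x, P x.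
Proof. by move=> h x; rewrite -(env_reprK x). Qed.

Lemma env_piD t t' : env_pi (t + t') = env_pi t + env_pi t'.
Proof. by rewrite /env_pi unlock; apply: Quotient.pi_add. Qed.

Definition env_one : env := env_pi 1.
Definition env_mul (x y : env) : env := env_pi (env_repr x * env_repr y).
Definition env_scale (k : K) (x : env) : env := env_pi (k *: env_repr x).

Lemma env_reprP t : env_ideal (t - env_repr (env_pi t)).
Proof. by apply/env_piP; rewrite env_reprK. Qed.

Lemma env_piM t t' : env_mul (env_pi t) (env_pi t') = env_pi (t * t').
Proof.
apply/esym/env_piP.
set r := env_repr (env_pi t); set r' := env_repr (env_pi t').
have -> : t * t' - r * r' = t * (t' - r') + (t - r) * r'.
  by rewrite mulrBr mulrBl addrA subrK.
by apply: env_idealD; [apply: env_idealMl | apply: env_idealMr];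
  apply: env_reprP.
Qed.

Lemma env_piZ k t : env_scale k (env_pi t) = env_pi (k *: t).
Proof.
apply/esym/env_piP; rewrite -scalerBr -mul_malgC; apply: env_idealMl.
exact: env_reprP.
Qed.

Lemma env_mulA : associative env_mul.
Proof.
elim/env_ind=> t; elim/env_ind=> u; elim/env_ind=> v.
by rewrite !env_piM mulrA.
Qed.
Lemma env_mul1 : left_id env_one env_mul.
Proof. by elim/env_ind=> t; rewrite env_piM mul1r. Qed.
Lemma env_1mul : right_id env_one env_mul.
Proof. by elim/env_ind=> t; rewrite env_piM mulr1. Qed.
Lemma env_mulDl : left_distributive env_mul +%R.
Proof.
elim/env_ind=> t; elim/env_ind=> u; elim/env_ind=> v.
by rewrite -env_piD !env_piM -env_piD mulrDl.
Qed.
Lemma env_mulDr : right_distributive env_mul +%R.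
Proof.
elim/env_ind=> t; elim/env_ind=> u; elim/env_ind=> v.
by rewrite -env_piD !env_piM -env_piD mulrDr.
Qed.

Let aug : tensor_alg -> K := mcoeff (mone : {fmonom (lie0 g + lie1 g)%type}).
Let augM r s : aug (r * s) = aug r * aug s.
Proof. exact: (mcoeff1g_is_multiplicative _ _).1. Qed.
Let aug_gen i : aug << fmu i >> = 0.
Proof. by rewrite /aug mcoeffU1 fmP fmuE fm1. Qed.

Lemma env_ideal_aug t : env_ideal t -> aug t = 0.
Proof.
have aD r s : aug (r + s) = aug r + aug s by exact: mcoeffD.
have aB r s : aug (r - s) = aug r - aug s by exact: mcoeffB.
have aZ k r : aug (k *: r) = k * aug r by exact: mcoeffZ.
elim=> [{}t||r s _ hr _ hs|s r _ h|s r _ h].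
- case=> [k x y|k u v|x y|x u|u v].
  + by apply: (aug_lin aB aD aZ); apply: aug_gen.
  + by apply: (aug_lin aB aD aZ); apply: aug_gen.
  + by apply: (aug_comm aB augM); apply: aug_gen.
  + by apply: (aug_comm aB augM); apply: aug_gen.
  + by apply: (aug_acomm aB aD augM); apply: aug_gen.
- exact: mcoeff0.
- by rewrite (aD r s) hr hs addr0.
- by rewrite (augM s r) h mulr0.
- by rewrite (augM r s) h mul0r.
Qed.

Lemma env_one_neq0 : env_one != 0.
Proof.
have p0 : env_pi 0 = 0.
  by apply: (addrI (env_pi 0)); rewrite -env_piD !addr0.
apply/eqP => h; have /env_piP /env_ideal_aug : env_pi 1 = env_pi 0 by rewrite p0.
by rewrite subr0 /aug mcoeff1 eqxx => /eqP; rewrite oner_eq0.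
Qed.

HB.instance Definition _ := GRing.Zmodule_isNzRing.Build env
  env_mulA env_mul1 env_1mul env_mulDl env_mulDr env_one_neq0.

Lemma env_scaleA k l x : env_scale k (env_scale l x) = env_scale (k * l) x.
Proof. by elim/env_ind: x => t; rewrite !env_piZ scalerA. Qed.
Lemma env_scale1 : left_id 1 env_scale.
Proof. by elim/env_ind=> t; rewrite env_piZ scale1r. Qed.
Lemma env_scaleDr : right_distributive env_scale +%R.
Proof.
move=> k; elim/env_ind=> t; elim/env_ind=> u.
by rewrite -env_piD !env_piZ -env_piD scalerDr.
Qed.
Lemma env_scaleDl x : {morph env_scale^~ x : k l / k + l}.
Proof.
by elim/env_ind: x => t k l; rewrite !env_piZ -env_piD scalerDl.
Qed.

HB.instance Definition _ := GRing.Zmodule_isLmodule.Build K env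
  env_scaleA env_scale1 env_scaleDr env_scaleDl.

Lemma env_scaleAl k (x y : env) : k *: (x * y) = k *: x * y.
Proof.
change (env_scale k (env_mul x y) = env_mul (env_scale k x) y).
elim/env_ind: x => t; elim/env_ind: y => u.
by rewrite env_piM !env_piZ env_piM scalerAl.
Qed.

HB.instance Definition _ := GRing.Lmodule_isLalgebra.Build K env env_scaleAl.

Lemma env_scaleAr k (x y : env) : k *: (x * y) = x * (k *: y).
Proof.
change (env_scale k (env_mul x y) = env_mul x (env_scale k y)).
elim/env_ind: x => t; elim/env_ind: y => u.
rewrite env_piM !env_piZ env_piM; congr env_pi.
apply/malgP => m; rewrite (mcoeffZ k (t * u) m) (mcoeffMl t u m).
rewrite (@mcoeffMlw _ _ (msupp t) (msupp u)) ?msuppZ_le // mulr_sumr.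
apply: eq_bigr => i _; rewrite mulr_sumr; apply: eq_bigr => j _.
by rewrite mcoeffZ mulrCA mulrnAr.
Qed.

HB.instance Definition _ := GRing.Lalgebra_isAlgebra.Build K env env_scaleAr.

Definition ienv0 (x : lie0 g) : env := env_pi (tgen0 x).
Definition ienv1 (u : lie1 g) : env := env_pi (tgen1 u).

End Enveloping.

(* (f, g) stands for f + g theta, where theta commutes with everything and     *)
(* theta^2 = 0.  C^oo[S^{1|1}] is superfun (cinf R), and C^oo[S^{1|1}; A] is   *)
(* superfun (grassmann (cinf R)).                                              *)
Definition superfun (T : pzRingType) : Type := (T * T)%type.
HB.instance Definition _ (T : pzRingType) :=
  GRing.Zmodule.copy (superfun T) (T * T)%type.

Section Superfun.
Variable T : pzRingType.
Implicit Types F G H : superfun T.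

Definition sf_mul F G : superfun T := (F.1 * G.1, F.1 * G.2 + F.2 * G.1).

Lemma sf_mulA : associative sf_mul.
Proof.
move=> F G H; rewrite /sf_mul /= mulrA; congr (_, _).
by rewrite mulrDr mulrDl !mulrA addrA.
Qed.
Lemma sf_mul1 : left_id ((1, 0) : superfun T) sf_mul.
Proof. by case=> a b; rewrite /sf_mul /= !mul1r mul0r addr0. Qed.
Lemma sf_1mul : right_id ((1, 0) : superfun T) sf_mul.
Proof. by case=> a b; rewrite /sf_mul /= !mulr1 mulr0 add0r. Qed.
Lemma sf_mulDl : left_distributive sf_mul +%R.
Proof.
move=> F G H; rewrite /sf_mul /= !mulrDl; congr (_, _).
by rewrite addrACA.
Qed.
Lemma sf_mulDr : right_distributive sf_mul +%R.
Proof.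
move=> F G H; rewrite /sf_mul /= !mulrDr; congr (_, _).
by rewrite addrACA.
Qed.
HB.instance Definition _ := GRing.Zmodule_isPzRing.Build (superfun T)
  sf_mulA sf_mul1 sf_1mul sf_mulDl sf_mulDr.
End Superfun.

Section ContIdentities.
Variables (T : comNzRingType) (D : T -> T) (h : T).
Let D_add := forall x y, D (x + y) = D x + D y.
Let D_mul := forall x y, D (x * y) = D x * y + x * D y.
Variables (DD : D_add) (DM : D_mul) (Dh : D h = 0) (h2 : h *+ 2 = 1).
Implicit Types a b c u v w : T.

Let DN x : D (- x) = - D x.
Proof.
have D0 : D 0 = 0 by apply: (addrI (D 0)); rewrite -DD !addr0.
by apply/eqP; rewrite -addr_eq0 -DD addNr D0.
Qed.
Let DE := (DD, DN, DM, Dh).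

Lemma jac000 a b c :
  a * D (b * D c - D b * c) - D a * (b * D c - D b * c) =
  (a * D b - D a * b) * D c - D (a * D b - D a * b) * c +
  (b * D (a * D c - D a * c) - D b * (a * D c - D a * c)).
Proof. rewrite !DE; ring. Qed.

Lemma jac001 a b w :
  a * D (b * D w - h * (D b * w)) - h * (D a * (b * D w - h * (D b * w))) =
  (a * D b - D a * b) * D w - h * (D (a * D b - D a * b) * w) +
  (b * D (a * D w - h * (D a * w)) - h * (D b * (a * D w - h * (D a * w)))).
Proof. rewrite !DE; ring. Qed.

Lemma jac011 a u v :
  a * D (- (u * v) *+ 2) - D a * (- (u * v) *+ 2) =
  - ((a * D u - h * (D a * u)) * v) *+ 2 +
  - (u * (a * D v - h * (D a * v))) *+ 2.
Proof.
apply/eqP; rewrite -subr_eq0; apply/eqP.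
transitivity ((1 - h *+ 2) * (D a * u * v) *+ 2); last by rewrite h2 subrr mul0r mul0rn.
rewrite mulr2n !DE; ring.
Qed.

Lemma jac111 u v w :
  - (u * v) *+ 2 * D w - h * (D (- (u * v) *+ 2) * w) +
  (- (v * w) *+ 2 * D u - h * (D (- (v * w) *+ 2) * u)) +
  (- (w * u) *+ 2 * D v - h * (D (- (w * u) *+ 2) * v)) = 0.
Proof.
transitivity ((h *+ 2 - 1) * (D (u * v * w)) *+ 2); last by rewrite h2 subrr mul0r mul0rn.
rewrite !mulr2n !DE; ring.
Qed.
End ContIdentities.

Section Cont.
Variable R : realType.
Local Notation cinf := (cinf R).
Local Notation D := (@cderiv R).
Local Notation half := (2^-1 : R[i]).

(* The vector fields L(a) = a d_phi + (1/2) a' theta d_theta and               *)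
(* M(b) = b theta d_phi - b d_theta on C^oo[S^{1|1}].                          *)
Definition vfL (a : cinf) (F : superfun cinf) : superfun cinf :=
  (a * D F.1, a * D F.2 + half *: (D a * F.2)).

Definition vfM (b : cinf) (F : superfun cinf) : superfun cinf :=
  (- (b * F.2), b * D F.1).

Definition cont_br00 (a c : cinf) : cinf := a * D c - D a * c.
Definition cont_br01 (a b : cinf) : cinf := a * D b - half *: (D a * b).
Definition cont_br11 (b c : cinf) : cinf := - (b * c) *+ 2.

Let DD : forall x y, D (x + y) = D x + D y := @cderivD R.
Let DM := @cderivM R.
Let h : cinf := half%:A.
Let Dh : D h = 0. Proof. exact: cderiv_const. Qed.
Let h2 : h *+ 2 = 1.
Proof. by rewrite /h -scaler_nat scalerA mulfV ?pnatr_eq0 // scale1r. Qed.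
Let derivN x : D (- x) = - D x.
Proof. by rewrite -scaleN1r cderivZ scaleN1r. Qed.
Let hE (x : cinf) : half *: x = h * x. Proof. by rewrite /h mulr_algl. Qed.

(* The brackets above are the supercommutators of these vector fields.         *)
Lemma vfL_vfL a c F :
  vfL a (vfL c F) - vfL c (vfL a F) = vfL (cont_br00 a c) F.
Proof.
case: F => f g; rewrite /vfL /cont_br00 /= !hE.
by congr (_, _); rewrite /= !(DD, DM, derivN, Dh); move: h => h'; ring.
Qed.

Lemma vfL_vfM a b F :
  vfL a (vfM b F) - vfM b (vfL a F) = vfM (cont_br01 a b) F.
Proof.
case: F => f g; rewrite /vfL /vfM /cont_br01 /= !hE.
congr (_, _); rewrite /= !(DD, DM, derivN, Dh); first by move: h => h'; ring.
apply/eqP; rewrite -subr_eq0; apply/eqP.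
transitivity ((h *+ 2 - 1) * (D a * b * D f)); last by rewrite h2 subrr mul0r.
by rewrite mulr2n; move: h => h'; ring.
Qed.

Lemma vfM_vfM b c F :
  vfM b (vfM c F) + vfM c (vfM b F) = vfL (cont_br11 b c) F.
Proof.
case: F => f g; rewrite /vfL /vfM /cont_br11 /= !hE.
congr (_, _); rewrite /= !(DD, DM, derivN, Dh, mulr2n); first by ring.
apply/eqP; rewrite -subr_eq0; apply/eqP.
transitivity ((h *+ 2 - 1) * (D (b * c) * g)); last by rewrite h2 subrr mul0r.
by rewrite DM mulr2n; move: h => h'; ring.
Qed.

Lemma cont_br00_linear x : linear (cont_br00 x).
Proof.
move=> k y z; rewrite /cont_br00 cderivD cderivZ !mulrDr -!scalerAr.
by rewrite opprD addrACA scalerBr.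
Qed.

Lemma cont_br01_linearr x : linear (cont_br01 x).
Proof.
move=> k y z; rewrite /cont_br01 cderivD cderivZ !mulrDr -!scalerAr scalerDr.
rewrite opprD addrACA scalerBr; congr (_ - _ + _).
by rewrite [LHS]scalerA [RHS]scalerA mulrC.
Qed.

Lemma cont_br01_linearl v : linear (cont_br01^~ v).
Proof.
move=> k y z; rewrite /cont_br01 cderivD cderivZ !mulrDl -!scalerAl scalerDr.
rewrite opprD addrACA scalerBr; congr (_ - _ + _).
by rewrite [LHS]scalerA [RHS]scalerA mulrC.
Qed.

Lemma cont_br11_linear u : linear (cont_br11 u).
Proof.
move=> k y z; rewrite /cont_br11 mulrDr -scalerAr opprD mulrnDl.
by rewrite -scalerN scalerMnr.
Qed.

Lemma cont_br00_anti x y : cont_br00 x y = - cont_br00 y x.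
Proof. by rewrite /cont_br00 opprB [y * _]mulrC [_ * x]mulrC. Qed.

Lemma cont_br11_sym u v : cont_br11 u v = cont_br11 v u.
Proof. by rewrite /cont_br11 mulrC. Qed.

Lemma cont_jacobi000 x y z : cont_br00 x (cont_br00 y z) =
  cont_br00 (cont_br00 x y) z + cont_br00 y (cont_br00 x z).
Proof. exact: (jac000 DD DM). Qed.

Lemma cont_jacobi001 x y w : cont_br01 x (cont_br01 y w) =
  cont_br01 (cont_br00 x y) w + cont_br01 y (cont_br01 x w).
Proof. rewrite /cont_br01 !hE; exact: (jac001 DD DM Dh). Qed.

Lemma cont_jacobi011 x u v : cont_br00 x (cont_br11 u v) =
  cont_br11 (cont_br01 x u) v + cont_br11 u (cont_br01 x v).
Proof. rewrite /cont_br01 !hE; exact: (jac011 DD DM h2). Qed.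

Lemma cont_jacobi111 u v w :
  cont_br01 (cont_br11 u v) w + cont_br01 (cont_br11 v w) u +
  cont_br01 (cont_br11 w u) v = 0.
Proof. rewrite /cont_br01 !hE; exact: (jac111 DD DM h2). Qed.

Definition cont : lieSuperalgebra R[i] := LieSuperalgebra
  cont_br00_linear cont_br01_linearl cont_br01_linearr cont_br11_linear
  cont_br00_anti cont_br11_sym
  cont_jacobi000 cont_jacobi001 cont_jacobi011 cont_jacobi111.
End Cont.

Definition is_subgroup (A : pzRingType) (H : set A) : Prop :=
  [/\ forall x, H x -> exists y, x * y = 1 /\ y * x = 1,
      H 1,
      forall x y, H x -> H y -> H (x * y) &
      forall x y, H x -> x * y = 1 -> y * x = 1 -> H y].

Section SurplaceGroup.
Variables (K : numFieldType) (g : lieSuperalgebra K).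

Definition surplace_generators : set (grassmann (env g)) := fun z =>
  (exists (s : K) (I : {fset nat}) (x : lie0 g),
     [/\ ~~ odd #|` I|, (0 < #|` I|)%N & z = 1 + mono s I (ienv0 x)]) \/
  (exists (s : K) (I : {fset nat}) (y : lie1 g),
     odd #|` I| /\ z = 1 + mono s I (ienv1 y)).

Definition surplace : set (grassmann (env g)) :=
  smallest (@is_subgroup (grassmann (env g))) surplace_generators.
End SurplaceGroup.
Arguments surplace {K} g _.

Section Substitutions.
Variable R : realType.
Local Notation cinf := (cinf R).
Local Notation coef := (grassmann cinf).
Local Notation sfun := (superfun coef).

Definition gscal (f : cinf) : sfun := (gmon fset0 f, 0).
Definition gconst (I : {fset nat}) : sfun := (gmon I 1, 0).
Definition theta : sfun := (0, 1).

Definition gderiv (f : coef) : coef :=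
  \sum_(I <- msupp f) gmon I (cderiv f@_I).
Definition d_phi (F : sfun) : sfun := (gderiv F.1, gderiv F.2).
Definition d_theta (F : sfun) : sfun := (F.2, 0).

(* f (phi + W) = \sum_n f^(n) (phi) W^n / n! for nilpotent W; the sum stops at *)
(* any m with W^m = 0.                                                         *)
Definition taylor (f : cinf) (W : sfun) : sfun :=
  \sum_(n < xget 0%N [set m | W ^+ m = 0])
     gscal ((n`!%:R : R[i])^-1 *: iter n (@cderiv R) f) * W ^+ n.

(* The substitution phi |-> phi + sub_incr, theta |-> sub_theta.               *)
Record substitution := Substitution { sub_incr : sfun; sub_theta : sfun }.

(* f + g theta |-> f (phi + W) + g (phi + W) Theta for scalar f and g,         *)
(* extended to coefficients in A by right A-linearity.  As theta commutes with *)
(* A the side matters: it is for right A-linear operators, on which U(g) (x) A *)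
(* acts by left multiplications in A, that products in U(g) (x) A are          *)
(* compositions.                                                               *)
Definition subst (T : substitution) (F : sfun) : sfun :=
  \sum_(I <- msupp F.1) taylor F.1@_I (sub_incr T) * gconst I +
  \sum_(I <- msupp F.2) taylor F.2@_I (sub_incr T) * sub_theta T * gconst I.

(* subst (sub_comp T1 T2) = subst T1 \o subst T2                               *)
Definition sub_comp (T1 T2 : substitution) : substitution :=
  Substitution (sub_incr T1 + subst T1 (sub_incr T2)) (subst T1 (sub_theta T2)).

Definition gbody (x : coef) : cinf := x@_fset0.
Definition geven (x : coef) : Prop := forall I, x@_I != 0 -> ~~ odd #|` I|.
Definition godd (x : coef) : Prop := forall I, x@_I != 0 -> odd #|` I|.

(* Diffeomorphisms phi |-> Q + q theta, theta |-> R theta + r with Q reducing  *)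
(* to phi and R to 1 when all the a_j are put to 0; Q = phi + (sub_incr T).1   *)
(* has values in R / 2pi Z, while Q - phi is an honest function on S^1.        *)
Definition surplace_diffeo (T : substitution) : Prop :=
  [/\ geven (sub_incr T).1 /\ gbody (sub_incr T).1 = 0,
      godd (sub_incr T).2,
      geven (sub_theta T).2 /\ gbody (sub_theta T).2 = 1 &
      godd (sub_theta T).1].

(* (F, G) stands for the 1-form dphi F + dtheta G; forms are a right module    *)
(* over C^oo[S^{1|1}; A], so that pullbacks are right A-linear like subst.     *)
Definition form : Type := (sfun * sfun)%type.
Definition form_mul (w : form) (h : sfun) : form := (w.1 * h, w.2 * h).
Definition form_add (w w' : form) : form := (w.1 + w'.1, w.2 + w'.2).
Definition diff (F : sfun) : form := (d_phi F, d_theta F).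
Definition dphi : form := (1, 0).
Definition dtheta : form := (0, 1).

Definition pullback (T : substitution) (w : form) : form :=
  form_add (form_mul (form_add dphi (diff (sub_incr T))) (subst T w.1))
           (form_mul (diff (sub_theta T)) (subst T w.2)).

(* Omega = dphi + theta dtheta                                                 *)
Definition Omega : form := form_add dphi (form_mul dtheta theta).

Definition is_contact (T : substitution) : Prop :=
  exists h : sfun, pullback T Omega = form_mul Omega h.

Definition SCont : set (substitution) := fun T => surplace_diffeo T /\ is_contact T.

(* 1 + lambda L(a) acts as (phi, theta) |->                                    *)
(* (phi + lambda a, theta + (1/2) lambda a' theta).                            *)
Definition subL (s : R[i]) (I : {fset nat}) (a : cinf) : substitution :=
  Substitution (mono s I a, 0) (0, 1 + mono s I ((2^-1 : R[i]) *: cderiv a)).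

(* 1 + mu M(b) acts as (phi, theta) |-> (phi + mu b theta, theta - mu b).      *)
Definition subM (s : R[i]) (I : {fset nat}) (b : cinf) : substitution :=
  Substitution (0, mono s I b) (- mono s I b, 1).

Definition ContV : set (grassmann (env (cont R))) := surplace (cont R).

Definition natural_hom (Phi : grassmann (env (cont R)) -> substitution) : Prop :=
  [/\ forall x y, ContV x -> ContV y -> Phi (x * y) = sub_comp (Phi x) (Phi y),
      forall (s : R[i]) (I : {fset nat}) (a : lie0 (cont R)),
        ~~ odd #|` I| -> (0 < #|` I|)%N ->
        Phi (1 + mono s I (ienv0 a)) = subL s I a &
      forall (s : R[i]) (I : {fset nat}) (b : lie1 (cont R)),
        odd #|` I| -> Phi (1 + mono s I (ienv1 b)) = subM s I b].
End Substitutions.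

(* Main.v *)
Require Import Defs.
From mathcomp Require Import all_boot all_order all_algebra.
From mathcomp Require Import finmap monalg complex.
From mathcomp Require Import all_classical all_reals.
From mathcomp Require Import ring zify.

(* Order the monomials a_I by the code sum_(i in I) 2^i of I.  Since a_I a_J   *)
(* is 0 or +- a_(I u J), of code the sum of the codes, a product of generators *)
(* 1 + a_I X can be rearranged by increasing codes: two equal indices merge,   *)
(* and a swap of different ones only creates a factor of larger code.          *)
(*                                                                             *)
(* The algebra U(g) acts on functions on S^{1|1} enlarged by the coordinate    *)
(* phi.  A group element x goes to the substitution given by its values at phi *)
(* and theta; as the generators act on even functions by ring morphisms,       *)
(* substituting is the same as acting by x, so that products go to             *)
(* compositions.  If x goes to the identity, its first factor 1 + a_I X is     *)
(* trivial, because X is an element of g and so is determined by X phi; by     *)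
(* induction on the code x = 1.                                                *)
(*                                                                             *)
(* The substitution phi + A + B theta, R theta + r is contact if and only if   *)
(* B + R r = 0 and R^2 = 1 + A' + r' r.  So its coefficients at the first I    *)
(* that occurs are those of some 1 + a_I L(a) or 1 + a_I M(b).  Composing with *)
(* the inverse of that generator raises the first code, and the codes are      *)
(* bounded because only finitely many a_j occur.                               *)

Set Implicit Arguments.
Unset Strict Implicit.
Unset Printing Implicit Defensive.
Import Order.TTheory GRing.Theory Num.Theory.
Local Open Scope ring_scope.

(** * Codes of finite sets *)

Section SubsetCode.
Implicit Types I J K : {fset nat}.

(** The filtration of a Grassmann algebra by [code_ge] drives both halves of the proof. It is
    multiplicative ([gsuppM_code]), and an element in finitely many a_j whose codes exceed all
    subsets of these a_j is 0 ([gsupp_in_code]). So any procedure that keeps raising the least code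
    comes to an end.

    The parameter of a generator satisfies a_I x a_I = 0 ([gmon_sandwich]). Hence Taylor expansion
    along a generator stops at first order, and its substitution is a first order operator [gen_op]
    ([subst_gen]) that is multiplicative when the left factor is even. That operator turns f(phi +
    W) into f of the new argument ([taylor_sum_generator]), which makes products correspond to
    compositions ([subst_gen_comp], [Phi_hom]), and it preserves the two contact equations
    ([opL_contact], [opM_contact]), so that images are contact.

    For injectivity, [gens_collect] writes a group element as one generator of least code times
    generators of larger code. Acting on phi recovers the parameter of the first one, since L(a) phi
    = a and M(b) phi = b theta ([kernel_step], [kernel_trivial]).

    For surjectivity, the contact equations become linear at the least code, because products of two
    terms have larger code ([leading_contact]). The lowest terms are then those of a generator,
    which is divided off ([leading_step], [Phi_surj]). *)

Definition fcode I : nat := (\sum_(i <- I) 2 ^ i)%N.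

Lemma fcodeU I J : [disjoint I & J]%fset ->
  fcode (I `|` J)%fset = (fcode I + fcode J)%N.
Proof. exact: big_fsetU_disj. Qed.

Lemma fcode0 : fcode fset0 = 0%N.
Proof. by rewrite /fcode big_seq_fset0. Qed.

Lemma sum_expn2_lt (s : seq nat) n : uniq s -> all (fun i => i < n)%N s ->
  (\sum_(i <- s) 2 ^ i < 2 ^ n)%N.
Proof.
move=> us /allP ltn.
(* As a sum over a part of [iota 0 n], it is bounded by 1 + 2 + ... + 2^(n-1). *)
have -> : (\sum_(i <- s) 2 ^ i = \sum_(i <- iota 0 n | i \in s) 2 ^ i)%N.
  rewrite -[RHS]big_filter; apply: perm_big; apply: uniq_perm => //.
    exact/filter_uniq/iota_uniq.
  move=> i; rewrite mem_filter mem_iota /= add0n.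
  by case: (boolP (i \in s)) => //= /ltn.
elim: n {ltn} => [|n ih]; first by rewrite big_nil.
rewrite -[in iota _ _]addn1 iotaD big_cat add0n /= big_cons big_nil expnS mul2n
  -addnn -addSn.
by apply: leq_add => //; case: ifP => _ /=; lia.
Qed.

Lemma fcode_lt I n : (forall i, i \in I -> i < n)%N -> (fcode I < 2 ^ n)%N.
Proof. by move=> In; apply: sum_expn2_lt; [exact: fset_uniq|exact/allP]. Qed.

(** Binary digits: the terms below i add up to less than 2^i and those above i to a multiple of
    2^(i+1), so digit i of the code tells whether i is in I. Hence codes separate finite sets and
    order them totally. *)
Lemma mem_fcode I i : (i \in I) = odd (fcode I %/ 2 ^ i).
Proof.
rewrite /fcode (bigID (fun j => j < i)%N) /=.
rewrite [X in ((_ + X) %/ _)%N](bigID (fun j => j == i)) /=.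
set lo := (X in (X + _)%N); set mi := (X in (_ + (X + _))%N).
set hi := (X in (_ + (_ + X))%N).
have lo_lt : (lo < 2 ^ i)%N.
  rewrite /lo -big_filter; apply: sum_expn2_lt; first exact/filter_uniq/fset_uniq.
  by apply/allP => j; rewrite mem_filter => /andP[].
have midE : mi = ((i \in I) * 2 ^ i)%N.
  rewrite /mi (eq_bigl (fun j => j == i)) => [|j]; last first.
    by case: (eqVneq j i) => [->|]; rewrite ?ltnn ?andbF.
  case: (boolP (i \in I)) => iI; last first.
    rewrite mul0n big_seq_cond big1 // => j /andP[jI /eqP ji].
    by rewrite -ji jI in iI.
  by rewrite -big_filter filter_pred1_uniq // big_seq1 mul1n.
have /dvdnP[h hE] : (2 ^ i.+1 %| hi)%N.
  rewrite /hi; apply: dvdn_sum => j /andP[]; rewrite -leqNgt => ij nij.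
  by apply: dvdn_exp2l; rewrite ltn_neqAle eq_sym nij ij.
rewrite hE midE expnS.
rewrite (_ : _ + _ = (h * 2 + (i \in I)) * 2 ^ i + lo)%N; last by lia.
by rewrite divnMDl ?expn_gt0 // (divn_small lo_lt) addn0 oddD muln2 odd_double;
  case: (i \in I).
Qed.

Lemma fcode_inj : injective fcode.
Proof. by move=> I J eIJ; apply/fsetP => i; rewrite !mem_fcode eIJ. Qed.

Lemma fcode_eq0 I : (fcode I == 0%N) = (I == fset0).
Proof. by rewrite -(inj_eq fcode_inj) fcode0. Qed.

End SubsetCode.

(** * Supports and parity in Grassmann algebras *)

Section CoefficientwiseSums.
Variables (S : pzRingType) (V : zmodType) (h : {fset nat} -> S -> V).
Hypothesis hD : forall I, {morph h I : a b / a + b}.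

(** The common shape of [gderiv] and of the two halves of [subst], which unfold to it; additivity
    and the values on monomials are thus proved once. *)
Definition glin (x : grassmann S) : V := \sum_(I <- msupp x) h I x@_I.

Lemma glin_at0 I : h I 0 = 0.
Proof. by apply: (addrI (h I 0)); rewrite -hD !addr0. Qed.

Lemma glinw (A : {fset {fset nat}}) x : (msupp x `<=` A)%fset ->
  glin x = \sum_(I <- A) h I x@_I.
Proof. exact: (big_msuppw glin_at0). Qed.

Lemma glin_mon I a : glin (gmon I a) = h I a.
Proof. by rewrite (@glinw [fset I]%fset) ?msuppU_le // big_seq_fset1 mcoeffUU. Qed.

Lemma glinD : {morph glin : x y / x + y}.
Proof.
move=> x y; pose A := (msupp x `|` msupp y)%fset.
rewrite (@glinw A) ?msuppD_le // (@glinw A x) ?fsubsetUl //.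
rewrite (@glinw A y) ?fsubsetUr // -big_split; apply: eq_bigr => I _ /=.
by rewrite mcoeffD hD.
Qed.

Lemma glin0 : glin 0 = 0.
Proof. by rewrite /glin msupp0 big_seq_fset0. Qed.

End CoefficientwiseSums.

Section Grading.
Variable S : pzRingType.
Implicit Types (x y z : grassmann S) (I J K : {fset nat}) (a b c : S).
Implicit Types P Q : {fset nat} -> Prop.

(** One predicate serves for parity ([geven] and [godd] are instances up to conversion), for the
    filtration by codes and for bounds on the a_j that occur. *)
Definition gsupp P x : Prop := forall I, x@_I != 0 -> P I.

Lemma gmonM I J a b : gmon I a * gmon J b = gmulU I J a b.
Proof. exact: gmul_mon. Qed.

Lemma gsupp_mon P I a : P I -> gsupp P (gmon I a).
Proof.
by move=> PI J; rewrite mcoeffU; case: (eqVneq I J) => [<- //|_];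
  rewrite mulr0n eqxx.
Qed.

Lemma gsupp0 P : gsupp P (0 : grassmann S).
Proof. by move=> J; rewrite mcoeff0 eqxx. Qed.

Lemma gsuppD P x y : gsupp P x -> gsupp P y -> gsupp P (x + y).
Proof.
move=> Px Py I; rewrite mcoeffD; case: (eqVneq x@_I 0) => [->|/Px //].
by rewrite add0r => /Py.
Qed.

Lemma gsuppN P x : gsupp P x -> gsupp P (- x).
Proof. by move=> Px I; rewrite mcoeffN oppr_eq0 => /Px. Qed.

Lemma gsuppB P x y : gsupp P x -> gsupp P y -> gsupp P (x - y).
Proof. by move=> Px Py; apply: gsuppD => //; apply: gsuppN. Qed.

Lemma gsuppW P Q x : (forall I, P I -> Q I) -> gsupp P x -> gsupp Q x.
Proof. by move=> PQ Px I /Px /PQ. Qed.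

Lemma gsupp_ind P (T : grassmann S -> Prop) :
  T 0 -> (forall x y, T x -> T y -> T (x + y)) ->
  (forall I a, P I -> T (gmon I a)) -> forall x, gsupp P x -> T x.
Proof.
move=> T0 TD Tm x Px; rewrite (grassmannE x) big_seq.
by apply: (big_ind T) => // I; rewrite -mcoeff_neq0 => /Px; apply: Tm.
Qed.

Lemma gsuppM P Q (T : {fset nat} -> Prop) x y :
  (forall I J, [disjoint I & J]%fset -> P I -> Q J -> T (I `|` J)%fset) ->
  gsupp P x -> gsupp Q y -> gsupp T (x * y).
Proof.
move=> PQT Px Qy; move: x Px; apply: gsupp_ind => [|u v|I a PI].
- by rewrite mul0r; apply: gsupp0.
- by rewrite mulrDl; apply: gsuppD.
move: y Qy; apply: gsupp_ind => [|u v|J b QJ].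
- by rewrite mulr0; apply: gsupp0.
- by rewrite mulrDr; apply: gsuppD.
rewrite gmonM /gmulU; case: ifP => dIJ; last exact: gsupp0.
by apply: gsupp_mon; apply: PQT.
Qed.

Lemma gsupp1 P : P fset0 -> gsupp P (1 : grassmann S).
Proof. exact: gsupp_mon. Qed.

(** A shared index kills the product, whatever stands between. This is the nilpotency of the
    parameters of the generators, in the form that survives noncommuting coefficients. *)
Lemma gmon_sandwich I a b x : I != fset0 -> gmon I a * x * gmon I b = 0.
Proof.
move=> I0; elim/grassmann_ind: x => [|u v hu hv|J c].
- by rewrite mulr0 mul0r.
- by rewrite mulrDr mulrDl hu hv addr0.
rewrite gmonM /gmulU; case: ifP => _; last by rewrite mul0r.
rewrite gmonM /gmulU fdisjointUX; case: ifP => // /andP[/eqP].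
by rewrite fsetIid => /eqP; rewrite (negbTE I0).
Qed.

Definition even_set I : Prop := ~~ odd #|` I|.
Definition odd_set I : Prop := odd #|` I|.

Lemma card_fsetU_disj I J : [disjoint I & J]%fset ->
  #|` (I `|` J)%fset| = (#|` I| + #|` J|)%N.
Proof. by move/eqP => dIJ; rewrite cardfsU dIJ cardfs0 subn0. Qed.

Lemma gsuppM_ee x y : gsupp even_set x -> gsupp even_set y ->
  gsupp even_set (x * y).
Proof.
apply: gsuppM => I J dIJ; rewrite /even_set card_fsetU_disj // oddD.
by move=> /negbTE -> /negbTE ->.
Qed.

Lemma gsuppM_eo x y : gsupp even_set x -> gsupp odd_set y -> gsupp odd_set (x * y).
Proof.
apply: gsuppM => I J dIJ; rewrite /even_set /odd_set card_fsetU_disj // oddD.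
by move=> /negbTE -> ->.
Qed.

Lemma gsuppM_oe x y : gsupp odd_set x -> gsupp even_set y -> gsupp odd_set (x * y).
Proof.
apply: gsuppM => I J dIJ; rewrite /even_set /odd_set card_fsetU_disj // oddD.
by move=> -> /negbTE ->.
Qed.

Lemma gsuppM_oo x y : gsupp odd_set x -> gsupp odd_set y -> gsupp even_set (x * y).
Proof.
apply: gsuppM => I J dIJ; rewrite /even_set /odd_set card_fsetU_disj // oddD.
by move=> -> ->.
Qed.

Lemma gsupp_even1 : gsupp even_set (1 : grassmann S).
Proof. by apply: gsupp1; rewrite /even_set cardfs0. Qed.

Definition code_ge k I : Prop := (k <= fcode I)%N.

Lemma gsuppM_code k l x y :
  gsupp (code_ge k) x -> gsupp (code_ge l) y -> gsupp (code_ge (k + l)) (x * y).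
Proof.
by apply: gsuppM => I J dIJ kI lJ; rewrite /code_ge fcodeU // leq_add.
Qed.

Lemma gsupp_code0 x : gsupp (code_ge 0) x.
Proof. by []. Qed.

Lemma gsupp_code_le k l x : (l <= k)%N -> gsupp (code_ge k) x ->
  gsupp (code_ge l) x.
Proof. by move=> lk; apply: gsuppW => I; apply: leq_trans. Qed.

Lemma gsupp_coef0 k x I : gsupp (code_ge k) x -> (fcode I < k)%N -> x@_I = 0.
Proof. by move=> xk; apply: contraTeq => /xk; rewrite -leqNgt. Qed.

Lemma gsupp_code1 x : gsupp (code_ge 1) x <-> x@_fset0 = 0.
Proof.
split=> [/gsupp_coef0 -> //|x0 I xI]; first by rewrite fcode0.
rewrite /code_ge lt0n fcode_eq0; apply: contraNneq xI => ->.
by rewrite x0.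
Qed.

Definition in_gens n I : Prop := forall i, i \in I -> (i < n)%N.

Lemma gsuppM_in n x y : gsupp (in_gens n) x -> gsupp (in_gens n) y ->
  gsupp (in_gens n) (x * y).
Proof.
by apply: gsuppM => I J _ In Jn i; rewrite inE => /orP[/In|/Jn].
Qed.

Lemma in_gens0 n : in_gens n fset0.
Proof. by move=> i; rewrite inE. Qed.

Lemma gsupp_in_le m n x : (m <= n)%N -> gsupp (in_gens m) x -> gsupp (in_gens n) x.
Proof. by move=> mn; apply: gsuppW => I Im i /Im im; apply: leq_trans mn. Qed.

Lemma gsupp_in_ex x : exists n, gsupp (in_gens n) x.
Proof.
elim/grassmann_ind: x => [|x y [m xm] [n yn]|I a].
- by exists 0%N; apply: gsupp0.
- exists (maxn m n); apply: gsuppD.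
    by apply: gsupp_in_le xm; apply: leq_maxl.
  by apply: gsupp_in_le yn; apply: leq_maxr.
exists (\max_(i <- I) i).+1; apply: gsupp_mon => i iI.
by rewrite ltnS; apply: (@leq_bigmax_seq _ _ xpredT id i).
Qed.

(** Subsets of {0, ..., n-1} have codes below 2^n, so the filtration becomes 0 after finitely many
    steps once the a_j are bounded. *)
Lemma gsupp_in_code n k x : (2 ^ n <= k)%N ->
  gsupp (in_gens n) x -> gsupp (code_ge k) x -> x = 0.
Proof.
move=> nk xn xk; apply/malgP => I; rewrite mcoeff0.
apply/eqP; apply: contraT => xI.
by have := leq_ltn_trans (xk _ xI) (fcode_lt (xn _ xI)); rewrite ltnNge nk.
Qed.

Lemma gsupp_code_all x : (forall k, gsupp (code_ge k) x) -> x = 0.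
Proof. by have [n xn] := gsupp_in_ex x => /(_ (2 ^ n)%N); apply: gsupp_in_code. Qed.

End Grading.

(** Each pair of distinct i and j is inverted in exactly one of the two orders. This yields the sign
    rule for exchanging a_I and a_J. *)
Lemma ninv_sym I J : [disjoint I & J]%fset ->
  (ninv I J + ninv J I = #|` I| * #|` J|)%N.
Proof.
move=> /fdisjointP dIJ; rewrite /ninv [X in (_ + X)%N]exchange_big -big_split /=.
rewrite -[X in (X * _)%N]sum1_size big_distrl /= big_seq [RHS]big_seq.
apply: eq_bigr => i iI; rewrite -big_split /= mul1n -[RHS]sum1_size.
rewrite big_seq [RHS]big_seq; apply: eq_bigr => j jJ.
have : i != j by apply: contraTneq jJ => <-; apply: dIJ.
by case: ltngtP.
Qed.

Section SuperCommutation.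
Variable S : comPzRingType.
Implicit Types (x y : grassmann S) (I J : {fset nat}).

Lemma gmonC I J (a b : S) :
  gmon I a * gmon J b = (-1) ^+ (#|` I| * #|` J|) * (gmon J b * gmon I a).
Proof.
rewrite !gmonM /gmulU fdisjoint_sym.
case: ifPn => [dJI|]; last by rewrite mulr0.
rewrite fsetUC (mulrC a); move: (b * a) => c.
rewrite (_ : (-1) ^+ _ = gmon fset0 ((-1) ^+ (#|` I| * #|` J|)) :> grassmann S);
  last first.
  rewrite -signr_odd -[in RHS]signr_odd; case: (odd _) => //.
  by rewrite !expr1 /gmon monalgUN.
rewrite gmonM /gmulU fdisjoint0X ninv0l mul1r fset0U; congr gmon.
rewrite mulrA -exprD; congr (_ * _).
rewrite -(ninv_sym (I := I)) 1?fdisjoint_sym // -addnA addnn -mul2n exprD exprM.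
by rewrite sqrrN !expr1n mulr1.
Qed.

Lemma gevenC x y : gsupp even_set x -> x * y = y * x.
Proof.
move: x; apply: gsupp_ind => [|u v hu hv|I a evI].
- by rewrite mul0r mulr0.
- by rewrite mulrDl mulrDr hu hv.
elim/grassmann_ind: y => [|u v hu hv|J b].
- by rewrite mul0r mulr0.
- by rewrite mulrDl mulrDr hu hv.
by rewrite gmonC -signr_odd oddM (negbTE evI) mul1r.
Qed.

Lemma goddC x y : gsupp odd_set x -> gsupp odd_set y -> x * y = - (y * x).
Proof.
move=> ox oy; move: x ox; apply: gsupp_ind => [|u v hu hv|I a odI].
- by rewrite mul0r mulr0 oppr0.
- by rewrite mulrDl mulrDr hu hv opprD.
move: y oy; apply: gsupp_ind => [|u v hu hv|J b odJ].
- by rewrite mul0r mulr0 oppr0.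
- by rewrite mulrDl mulrDr hu hv opprD.
by rewrite gmonC -signr_odd oddM (idP odI) (idP odJ) mulN1r.
Qed.

End SuperCommutation.

(** * Superfunctions over a supercommutative ring *)

Section Superfunctions.
Variable A : pzRingType.
Implicit Types F G : superfun A.

Lemma sfP F G : F.1 = G.1 -> F.2 = G.2 -> F = G.
Proof. by case: F G => ? ? [] ? ? /= -> ->. Qed.

Lemma sfD1 F G : (F + G).1 = F.1 + G.1. Proof. by []. Qed.
Lemma sfD2 F G : (F + G).2 = F.2 + G.2. Proof. by []. Qed.
Lemma sfM1 F G : (F * G).1 = F.1 * G.1. Proof. by []. Qed.
Lemma sfM2 F G : (F * G).2 = F.1 * G.2 + F.2 * G.1. Proof. by []. Qed.
End Superfunctions.

(** A supercommutative ring, with parity as two predicates instead of a decomposition. The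
    computations with generators then take place in an abstract ring. *)
Record superparity (A : pzRingType) := Superparity {
  ev : A -> Prop;
  od : A -> Prop;
  ev0 : ev 0;
  od0 : od 0;
  ev1 : ev 1;
  evD : forall x y, ev x -> ev y -> ev (x + y);
  odD : forall x y, od x -> od y -> od (x + y);
  odN : forall x, od x -> od (- x);
  evM_ee : forall x y, ev x -> ev y -> ev (x * y);
  odM_eo : forall x y, ev x -> od y -> od (x * y);
  odM_oe : forall x y, od x -> ev y -> od (x * y);
  evM_oo : forall x y, od x -> od y -> ev (x * y);
  evN : forall x, ev x -> ev (- x);
  evC : forall x y, ev x -> x * y = y * x;
  odC : forall x y, od x -> od y -> x * y = - (y * x) }.

Section Supercommutative.
Variables (A : pzRingType) (p : superparity A).
Local Notation sfun := (superfun A).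
Local Notation ev := (ev p).
Local Notation od := (od p).
Implicit Types (x y : A) (F G W T : sfun).

(** For parity theta counts as odd, although it commutes with the odd coefficients. *)
Definition sf_even F : Prop := ev F.1 /\ od F.2.
Definition sf_odd F : Prop := od F.1 /\ ev F.2.

Lemma sf_even1 : sf_even 1.
Proof. by split; [apply: ev1|apply: od0]. Qed.

Lemma sf_evenD F G : sf_even F -> sf_even G -> sf_even (F + G).
Proof. by move=> [e1 o1] [e2 o2]; split; [apply: evD|apply: odD]. Qed.

Lemma sf_evenM F G : sf_even F -> sf_even G -> sf_even (F * G).
Proof.
move=> [e1 o1] [e2 o2]; split; first exact: evM_ee.
by apply: odD; [apply: odM_eo|apply: odM_oe].
Qed.

Lemma sf_evenX F n : sf_even F -> sf_even (F ^+ n).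
Proof.
move=> eF; elim: n => [|n ih]; first exact: sf_even1.
by rewrite exprS; apply: sf_evenM.
Qed.

(** As theta^2 = 0, two odd coefficients are never multiplied; every product that occurs has an even
    factor. *)
Lemma sf_evenC F G : sf_even F -> sf_even G -> F * G = G * F.
Proof.
move=> [e1 o1] [e2 o2]; apply: sfP; rewrite ?sfM1 ?sfM2; first exact: evC e1.
by rewrite addrC (evC _ e1) -(evC _ e2).
Qed.

(* The operators of the generators 1 + lambda L(a) and 1 + mu M(b) on          *)
(* superfunctions: [c] is lambda a, resp. mu b, and [k] is lambda a' / 2; the  *)
(* members of [Z] are the multiples of lambda, resp. mu.                       *)
Variables (d : A -> A) (Z : A -> Prop).
Hypothesis dD : {morph d : x y / x + y}.
Hypothesis dM : forall x y, d (x * y) = d x * y + x * d y.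
Hypothesis ev_d : forall x, ev x -> ev (d x).
Hypothesis od_d : forall x, od x -> od (d x).
Hypothesis Zd : forall x, Z x -> Z (d x).
Hypothesis Z0 : Z 0.
Hypothesis ZZ : forall x y z, Z x -> Z y -> x * z * y = 0.

Let d0 : d 0 = 0. Proof. by apply: (addrI (d 0)); rewrite -dD !addr0. Qed.
Let dN x : d (- x) = - d x.
Proof. by apply/eqP; rewrite -addr_eq0 -dD addNr d0. Qed.
Let d1 : d 1 = 0.
Proof. by apply: (addrI (d 1)); rewrite addr0 -{3}(mulr1 1) dM mulr1 mul1r. Qed.

(** With W = A + B theta and T = r + q theta, the first equation says that the dtheta coefficient of
    the pulled back form has no part free of theta; the second matches its theta part with the dphi
    coefficient. *)
Definition is_contact_pair W T : Prop :=
  W.2 + T.2 * T.1 = 0 /\ T.2 * T.2 = 1 + d W.1 + d T.1 * T.1.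

Section EvenGenerator.
Variables (c k : A).
Hypotheses (Zc : Z c) (Zk : Z k) (ec : ev c) (ek : ev k) (kE : k + k = d c).

(* The action of 1 + lambda L(a) on densities of weight [l]: weights add up in  *)
(* products, and [d] sends weight 0 to weight [d c].                           *)
Definition dens l x := x + c * d x + l * x.

Lemma densD l : {morph dens l : x y / x + y}.
Proof. by move=> x y; rewrite /dens dD !mulrDr (addrACA x) (addrACA (x + _)). Qed.

Lemma dens0 l : dens l 0 = 0.
Proof. by rewrite /dens d0 !mulr0 !addr0. Qed.

(** Terms with two factors from [Z] vanish, and those with one factor are given by the Leibniz
    rule. *)
Lemma densM l m x y : Z l -> Z m -> ev m ->
  dens l x * dens m y = dens (l + m) (x * y).
Proof.
move=> Zl Zm em; rewrite /dens dM.
have cC u v : u * (c * v) = c * (u * v) by rewrite mulrA -(evC u ec) mulrA.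
have mC u v : u * (m * v) = m * (u * v) by rewrite mulrA -(evC u em) mulrA.
have z u v w w' : Z u -> Z v -> u * w * (v * w') = 0.
  by move=> Zu Zv; rewrite mulrA (ZZ _ Zu Zv) mul0r.
rewrite !(mulrDl, mulrDr) !addrA !(z c c, z c m, z l c,
  z l m) // !addr0 cC mC !mulrA.
by rewrite (ACl (1*4*2*5*3)).
Qed.

Definition opL F : sfun := (dens 0 F.1, dens k F.2).

Lemma opLD : {morph opL : F G / F + G}.
Proof. by move=> F G; rewrite /opL sfD1 sfD2 !densD. Qed.

Lemma opLM F G : opL (F * G) = opL F * opL G.
Proof.
apply: sfP; rewrite /opL ?sfM1 ?sfM2 /= !densM //; try exact: ev0.
  by rewrite addr0.
by rewrite add0r addr0 densD.
Qed.

Lemma ev_dens l x : ev l -> ev x -> ev (dens l x).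
Proof.
by move=> el ex; do 2?apply: evD; rewrite //; apply: evM_ee => //; apply: ev_d.
Qed.

Lemma od_dens l x : ev l -> od x -> od (dens l x).
Proof.
by move=> el ox; do 2?apply: odD; rewrite //; apply: odM_eo => //; apply: od_d.
Qed.

Lemma opL_even F : sf_even F -> sf_even (opL F).
Proof.
by move=> [e1 o2]; split; [apply: ev_dens => //; apply: ev0|apply: od_dens].
Qed.

Lemma opL_odd F : sf_odd F -> sf_odd (opL F).
Proof.
by move=> [o1 e2]; split; [apply: od_dens => //; apply: ev0|apply: ev_dens].
Qed.

Lemma opL_const F j : d j = 0 -> opL (F * (j, 0)) = opL F * (j, 0).
Proof.
move=> dj; rewrite opLM; congr (_ * _); apply: sfP; rewrite /opL /=.
  by rewrite /dens dj mulr0 mul0r !addr0.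
exact: dens0.
Qed.

Lemma opL_scal x : ev x -> opL (x, 0) = (x, 0) + ((d x, 0) : sfun) * ((c, 0) :
  sfun) :> sfun.
Proof.
move=> ex; apply: sfP; rewrite ?sfD1 ?sfD2 ?sfM1 ?sfM2 /opL /=.
  by rewrite /dens mul0r addr0 (evC c (ev_d ex)).
by rewrite dens0 mulr0 mul0r !addr0.
Qed.

Lemma opL_theta : opL (0, 1) = (0, 1 + k).
Proof. by rewrite /opL /= dens0 /dens d1 mulr0 addr0 mulr1. Qed.

Lemma opL1 : opL 1 = 1.
Proof. by apply: sfP; rewrite /opL /= ?dens0 // /dens d1 mulr0 mul0r !addr0. Qed.

Lemma dens_d x : d (dens 0 x) = dens (d c) (d x).
Proof. by rewrite /dens mul0r addr0 dD dM addrA addrAC. Qed.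

Lemma dens_one l : dens l 1 = 1 + l.
Proof. by rewrite /dens d1 mulr0 addr0 mulr1. Qed.

(** The contact equations are homogeneous for the weights of [dens]: the first has weight k and the
    second has weight k + k = d c. Each is therefore carried to itself, the constant 1 of the second
    one producing the derivative of the new increment c. *)
Lemma opL_contact W T : is_contact_pair W T -> is_contact_pair (((c, 0) :
  sfun) + opL W) (opL T).
Proof.
move=> [WT TT]; have e0 := ev0 p; split.
  rewrite sfD2 add0r /opL /= densM // addr0 -densD WT dens0 //.
rewrite sfD1 /opL /= densM // kE dD !dens_d TT densM //; last exact: Zd.
by rewrite addr0 !densD dens_one !addrA.
Qed.
End EvenGenerator.

Section OddGenerator.
Variable c : A.
Hypotheses (Zc : Z c) (oc : od c).

Definition opM F : sfun := (F.1 - c * F.2, F.2 + c * d F.1).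

Lemma opMD : {morph opM : F G / F + G}.
Proof.
move=> F G; apply: sfP; rewrite /opM ?sfD1 ?sfD2 /= ?dD mulrDr ?opprD; exact:
  addrACA.
Qed.

Let cc x : c * x * c = 0. Proof. exact: ZZ. Qed.
Let ccA x y : c * x * (c * y) = 0. Proof. by rewrite mulrA cc mul0r. Qed.

(** Evenness of F makes c commute with its first coefficient and anticommute with its second, g. The
    terms c g g' and g c g', which arise because theta commutes with c, then cancel. *)
Lemma opMM F G : sf_even F -> opM (F * G) = opM F * opM G.
Proof.
move: F G => [f1 g1] [f2 g2] [/= ef og]; apply: sfP; rewrite ?sfM1 ?sfM2 /opM /=.
  rewrite mulrBl !mulrBr ccA subr0 mulrDr opprD (mulrA f1) (evC c ef) !mulrA.
  by rewrite addrA.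
rewrite dM !mulrDr !mulrDl !mulrN !mulNr !(ccA, subr0, oppr0, addr0).
rewrite (mulrA f1) (evC c ef) (mulrA g1) (odC og oc) mulNr opprK !mulrA.
by rewrite !addrA [RHS](ACl (1*4*5*3*6*2)) /= addrK.
Qed.

Lemma opM_const F j : d j = 0 -> opM (F * (j, 0)) = opM F * (j, 0).
Proof.
move=> dj; apply: sfP; rewrite ?sfM1 ?sfM2 /opM /= ?sfM1 ?sfM2 /= mulr0 add0r.
  by rewrite mulrBl mulrA.
by rewrite dM dj !mulr0 !(add0r, addr0) mulrDl mulrA.
Qed.

Lemma opM_scal x : ev x -> opM (x, 0) = (x, 0) + ((d x, 0) : sfun) * ((0, c) :
  sfun) :> sfun.
Proof.
move=> ex; apply: sfP; rewrite ?sfD1 ?sfD2 ?sfM1 ?sfM2 /opM /=.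
  by rewrite !mulr0 subr0 addr0.
by rewrite mul0r addr0 (evC c (ev_d ex)).
Qed.

Lemma opM_theta : opM (0, 1) = (- c, 1).
Proof. by rewrite /opM /= d0 mulr1 mulr0 add0r addr0. Qed.

Lemma opM1 : opM 1 = 1.
Proof. by apply: sfP; rewrite /opM /= ?d1 ?mulr0 ?subr0 ?addr0. Qed.

Lemma opM_even F : sf_even F -> sf_even (opM F).
Proof.
move=> [e1 o2]; split; first by apply: evD => //; apply: evN; apply: evM_oo.
by apply: odD => //; apply: odM_oe => //; apply: ev_d.
Qed.

Lemma opM_odd F : sf_odd F -> sf_odd (opM F).
Proof.
move=> [o1 e2]; split; first by apply: odD => //; apply: odN; apply: odM_oe.
by apply: evD => //; apply: evM_oo => //; apply: od_d.
Qed.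

(** The operator mixes the two components, so there are no weights to use, and the equations are
    expanded. Only terms of first order in c and d c survive. *)
Lemma opM_contact W T : sf_odd T ->
  is_contact_pair W T -> is_contact_pair (((0, c) : sfun) + opM W) (opM T).
Proof.
move: W T => [a b] [r q] [/= or eq] [/= WT TT].
have dc x : c * x * d c = 0 by apply: ZZ => //; apply: Zd.
have cd x : d c * x * c = 0 by apply: ZZ => //; apply: Zd.
(* The first contact equation eliminates b from the second one. *)
have bE : b = - (q * r) by apply/eqP; rewrite -addr_eq0 WT.
rewrite /is_contact_pair sfD1 sfD2 /opM /= add0r; split.
  have -> : (q + c * d r) * (r - c * q) = q * r - c * (q * q) + c * (d r * r).
    rewrite mulrDl !mulrBr ccA subr0 (mulrA q) (evC c eq) -(mulrA c q).
    by rewrite -(mulrA c (d r)).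
  rewrite TT !mulrDr mulr1 opprD [_ + (- _ - _)]addrA subrK addrCA -addrA.
  by rewrite opprD !addrA (ACl (3*1*2*5*4*6)) /= !addrK.
have -> : (q + c * d r) * (q + c * d r) = q * q + c * (q * d r) + c * (d r * q).
  by rewrite mulrDl !mulrDr ccA addr0 (mulrA q) (evC c eq) -!mulrA.
rewrite TT !dD !dN !dM.
have -> : (d r - (d c * q + c * d q)) * (r - c * q) =
    d r * r - d c * (q * r) - c * (d q * r) + c * (q * d r).
  rewrite mulrBl !mulrBr !mulrDl (mulrA (d c * q)) cd (mulrA (c * d q)) cc.
  rewrite !mul0r !addr0 subr0 opprD !mulrA (odC (od_d or) oc).
  rewrite mulNr opprK -(mulrA c (d r)) -(evC (d r) eq) !mulrA !addrA.
  by rewrite (ACl (1*3*4*2)).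
rewrite bE dN dM -(evC (d r) eq) !mulrN !mulrDr !opprD !opprK !addrA.
by rewrite [RHS](ACl (1*2*6*5*9*3*7*4*8)) /= !addrK.
Qed.
End OddGenerator.

(** To first order the two operators are inverse, and all second order terms have two factors from
    [Z]. *)
Lemma opLNK c k F : Z c -> Z k -> opL c k (opL (- c) (- k) F) = F.
Proof.
move=> Zc Zk; have z u v w : Z u -> Z v -> u * (v * w) = 0.
  by move=> Zu Zv; rewrite mulrA -[u]mulr1 (ZZ 1 Zu Zv) mul0r.
have densK l x : Z l -> dens c l (dens (- c) (- l) x) = x.
  move=> Zl; rewrite /dens !mulNr !dD !dN !dM !(mulrDr, mulrN).
  rewrite !(z c c, z c (d c), z c l, z c (d l), z l c, z l l) //; try exact: Zd.
  rewrite !(addr0, oppr0) (ACl (1*(2*4)*(3*5))) /= !addNr.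
  by rewrite !addr0.
by apply: sfP; [have := densK 0 F.1 Z0; rewrite oppr0|exact: densK].
Qed.

Lemma opMNK c F : Z c -> opM c (opM (- c) F) = F.
Proof.
move=> Zc; have z u v w : Z u -> Z v -> u * (v * w) = 0.
  by move=> Zu Zv; rewrite mulrA -[u]mulr1 (ZZ 1 Zu Zv) mul0r.
apply: sfP; rewrite /opM /= !mulNr opprK.
  by rewrite mulrDr mulrN (z c c) // oppr0 addr0 addrK.
by rewrite dD dM mulrDr mulrDr !(z c c, z c (d c)) ?addr0 ?subrK //; apply: Zd.
Qed.

(* [tc n f] stands for f^(n) / n!, and [W0] for the increment of phi under the *)
(* substitution [E].                                                           *)
Section Taylor.
Variables (S : zmodType) (D : S -> S) (tc : nat -> S -> S) (sc : S -> sfun).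
Hypothesis tc0 : forall f, tc 0%N f = f.
Hypothesis Dtc : forall n f, D (tc n f) = tc n.+1 f *+ n.+1.
Hypothesis scMn : forall f n, sc (f *+ n) = sc f *+ n.
Hypothesis sc_even : forall f, sf_even (sc f).

Definition taylor_sum m f W : sfun := \sum_(n < m) sc (tc n f) * W ^+ n.

Lemma taylor_sum_le f W k l : W ^+ k = 0 -> (k <= l)%N ->
  taylor_sum l f W = taylor_sum k f W.
Proof.
move=> Wk kl; rewrite /taylor_sum.
rewrite [RHS](big_ord_widen l (fun n => sc (tc n f) * W ^+ n) kl).
rewrite [RHS]big_mkcond; apply: eq_bigr => n _; case: ltnP => // kn.
by rewrite -(subnK kn) exprD Wk !mulr0.
Qed.

Lemma taylor_sum_sqr0 f W : taylor_sum 2 f W = sc f + sc (D f) * W.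
Proof.
rewrite /taylor_sum !big_ord_recl big_ord0 addr0 /=.
have := Dtc 0%N f; rewrite tc0 mulr1n => ->.
by rewrite expr0 mulr1 expr1.
Qed.

Variables (E : sfun -> sfun) (W0 : sfun).
Hypothesis ED : {morph E : F G / F + G}.
Hypothesis EM : forall F G, sf_even F -> E (F * G) = E F * E G.
Hypothesis Esc : forall f, E (sc f) = sc f + sc (D f) * W0.
Hypothesis E1 : E 1 = 1.
Hypothesis Eeven : forall F, sf_even F -> sf_even (E F).
Hypothesis W0even : sf_even W0.
Hypothesis W0sqr : W0 ^+ 2 = 0.

Lemma generatorX F n : sf_even F -> E (F ^+ n) = E F ^+ n.
Proof.
move=> eF; elim: n => [|n ih]; first by rewrite !expr0 E1.
by rewrite !exprS EM // ih.
Qed.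

Lemma sqr0_exprD F n : sf_even F ->
  (W0 + F) ^+ n.+1 = F ^+ n.+1 + W0 * F ^+ n *+ n.+1.
Proof.
move=> eF; elim: n => [|n ih]; first by rewrite !expr1 expr0 mulr1 mulr1n addrC.
rewrite exprS ih mulrDl !mulrDr -exprS.
have -> : W0 * (W0 * F ^+ n *+ n.+1) = 0.
  by rewrite mulrnAr mulrA -expr2 W0sqr mul0r mul0rn.
rewrite addr0 addrCA; congr (_ + _).
by rewrite mulrnAr mulrA -(sf_evenC W0even eF) -mulrA -exprS -mulrS.
Qed.

(** On Taylor coefficients, E adds n+1 times the next coefficient times [W0]. Since [W0] squares to
    0, (W0 + E W)^(n+1) is (E W)^(n+1) plus (n+1) W0 (E W)^n. After a shift of the index the two
    corrections are the same. *)
Lemma taylor_sum_generator m f W : sf_even W -> E W ^+ m = 0 ->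
  E (taylor_sum m.+1 f W) = taylor_sum m.+1 f (W0 + E W).
Proof.
move=> eW EWm; rewrite /taylor_sum (big_morph E ED (id1 := 0)); last first.
  by apply: (addrI (E 0)); rewrite -ED !addr0.
under eq_bigr => n _ do rewrite EM // generatorX // Esc mulrDl Dtc scMn.
(* The last term of the shifted sum involves the coefficient of order m+1, beyond the range on the
   right; it contains the m-th power of [E W], which is 0. *)
rewrite big_split /= [in X in _ + X]big_ord_recr /= EWm mulr0 addr0.
rewrite big_ord_recl [RHS]big_ord_recl !expr0 -addrA; congr (_ + _).
rewrite -big_split /=; apply: eq_bigr => n _.
rewrite (_ : bump 0 n = n.+1) // sqr0_exprD; last exact: Eeven.
by rewrite mulrDr mulrnAr mulrnAl mulrnAl -mulrA.
Qed.
End Taylor.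
End Supercommutative.

(** * Coefficientwise maps *)

Section CoefficientMaps.
Variables (S T : pzRingType) (f : S -> T).
Hypothesis fD : {morph f : a b / a + b}.

Definition gmap : grassmann S -> grassmann T := glin (fun I a => gmon I (f a)).

Lemma gmap_slotD I : {morph (fun a => gmon I (f a)) : a b / a + b}.
Proof. by move=> a b; rewrite fD gmonD. Qed.

Lemma gmapD : {morph gmap : x y / x + y}.
Proof. exact: glinD gmap_slotD. Qed.

Lemma gmap_mon I a : gmap (gmon I a) = gmon I (f a).
Proof. exact: (glin_mon gmap_slotD). Qed.

Lemma gmap0 : gmap 0 = 0.
Proof. exact: glin0. Qed.

Lemma morphD0 : f 0 = 0.
Proof. by apply: (addrI (f 0)); rewrite -fD !addr0. Qed.

Lemma morphD_opp a : f (- a) = - f a.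
Proof. by apply/eqP; rewrite -addr_eq0 -fD addNr morphD0. Qed.

Lemma morphD_signM n a : f ((-1) ^+ n * a) = (-1) ^+ n * f a.
Proof.
rewrite -signr_odd -[in RHS]signr_odd; case: (odd n); rewrite ?mul1r //.
by rewrite !expr1 !mulN1r morphD_opp.
Qed.

Lemma gmapE x I : (gmap x)@_I = f x@_I.
Proof.
elim/grassmann_ind: x => [|x y hx hy|J a].
- by rewrite gmap0 !mcoeff0 morphD0.
- by rewrite gmapD 2!mcoeffD fD hx hy.
by rewrite gmap_mon !mcoeffU; case: eqP => _; rewrite ?morphD0.
Qed.

Lemma gsupp_gmap P x : gsupp P x -> gsupp P (gmap x).
Proof.
move=> Px I; rewrite gmapE => fx; apply: Px.
by apply: contraNneq fx => ->; rewrite morphD0.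
Qed.
End CoefficientMaps.

Section Derivation.
Variables (S : pzRingType) (D : S -> S).
Hypothesis DD : {morph D : a b / a + b}.
Hypothesis DM : forall a b, D (a * b) = D a * b + a * D b.
Implicit Types (x y : grassmann S) (I J : {fset nat}) (a b : S).

Lemma gmap_deriv_gmulU I J a b :
  gmap D (gmulU I J a b) = gmulU I J (D a) b + gmulU I J a (D b).
Proof.
rewrite /gmulU; case: (boolP [disjoint I & J]%fset) => _;
  last by rewrite gmap0 addr0.
by rewrite (gmap_mon DD) (morphD_signM DD) DM mulrDr gmonD.
Qed.

Lemma gmap_derivM x y : gmap D (x * y) = gmap D x * y + x * gmap D y.
Proof.
elim/grassmann_ind: x => [|x x' hx hx'|I a].
- by rewrite !(mul0r, gmap0) addr0.
- by rewrite !(mulrDl, gmapD DD) hx hx' addrACA.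
elim/grassmann_ind: y => [|y y' hy hy'|J b].
- by rewrite !(mulr0, gmap0) addr0.
- by rewrite !(mulrDr, gmapD DD) hy hy' addrACA.
apply: etrans (congr1 (gmap D) (gmonM I J a b)) _.
apply: etrans (gmap_deriv_gmulU I J a b) _; rewrite !(gmap_mon DD).
exact: (congr2 +%R (esym (gmonM I J (D a) b)) (esym (gmonM I J a (D b)))).
Qed.
End Derivation.

Definition grassmann_parity (S : comPzRingType) : superparity (grassmann S) :=
  @Superparity (grassmann S) (gsupp even_set) (gsupp odd_set)
    (@gsupp0 _ _) (@gsupp0 _ _) (@gsupp_even1 _)
    (@gsuppD _ _) (@gsuppD _ _) (@gsuppN _ _) (@gsuppM_ee _) (@gsuppM_eo _)
    (@gsuppM_oe _) (@gsuppM_oo _) (@gsuppN _ _) (@gevenC _) (@goddC _).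

Section SuperfunctionSupport.
Variable S : pzRingType.
Local Notation sfun := (superfun (grassmann S)).
Implicit Types (F G W : sfun).

Definition sf_supp P F : Prop := gsupp P F.1 /\ gsupp P F.2.

Lemma sf_suppD P F G : sf_supp P F -> sf_supp P G -> sf_supp P (F + G).
Proof. by move=> [F1 F2] [G1 G2]; split; apply: gsuppD. Qed.

Lemma sf_codeX F n : sf_supp (code_ge 1) F -> sf_supp (code_ge n) (F ^+ n).
Proof.
move=> [F1 F2]; elim: n => [|n [ih1 ih2]]; first by split; apply: gsupp_code0.
rewrite exprS -add1n; split; first exact: gsuppM_code.
by apply: gsuppD; apply: gsuppM_code.
Qed.

Lemma sf_inM n F G : sf_supp (in_gens n) F -> sf_supp (in_gens n) G ->
  sf_supp (in_gens n) (F * G).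
Proof.
by move=> [F1 F2] [G1 G2]; split; [|apply: gsuppD]; apply: gsuppM_in.
Qed.

Lemma sf_inX n F m : sf_supp (in_gens n) F -> sf_supp (in_gens n) (F ^+ m).
Proof.
move=> Fn; elim: m => [|m ih]; last by rewrite exprS; apply: sf_inM.
by split; [apply: gsupp1; apply: in_gens0|apply: gsupp0].
Qed.

Lemma sf_in_ex F : exists n, sf_supp (in_gens n) F.
Proof.
have [n1 h1] := gsupp_in_ex F.1; have [n2 h2] := gsupp_in_ex F.2.
exists (maxn n1 n2); split.
  by apply: gsupp_in_le h1; apply: leq_maxl.
by apply: gsupp_in_le h2; apply: leq_maxr.
Qed.

(** If W involves only the first n of the a_j, its power of order 2^n has codes at least 2^n, more
    than these a_j can provide. *)
Lemma sf_nilpotent W : sf_supp (code_ge 1) W -> exists m, W ^+ m = 0.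
Proof.
move=> W1; have [n Wn] := sf_in_ex W.
exists (2 ^ n)%N; have [a1 a2] := sf_codeX (2 ^ n) W1.
have [b1 b2] := sf_inX (2 ^ n) Wn.
by apply: sfP; [exact: gsupp_in_code (leqnn _) b1 a1|exact:
  gsupp_in_code (leqnn _) b2 a2].
Qed.

Definition sf_scal (f : S) : sfun := (gmon fset0 f, 0).
Definition sf_const I : sfun := (gmon I 1, 0).
Definition sf_theta : sfun := (0, 1).

Lemma sf_scalD : {morph sf_scal : f g / f + g}.
Proof.
by move=> f g; apply: sfP; rewrite /sf_scal ?sfD1 ?sfD2 /= ?gmonD ?addr0.
Qed.

Lemma sf_scalMn f n : sf_scal (f *+ n) = sf_scal f *+ n.
Proof.
elim: n => [|n ih]; last by rewrite !mulrS sf_scalD ih.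
by rewrite !mulr0n /sf_scal gmon0.
Qed.

Lemma gmon_set0M J f (a : S) : gmon fset0 f * gmon J a = gmon J (f * a).
Proof. by rewrite gmonM /gmulU fdisjoint0X ninv0l mul1r fset0U. Qed.

Lemma sf_scal_const J f : sf_scal f * sf_const J = (gmon J f, 0).
Proof.
apply: sfP; rewrite ?sfM1 ?sfM2 /=.
  by apply: etrans (gmon_set0M J f 1) _; rewrite mulr1.
by rewrite mulr0 mul0r addr0.
Qed.

Lemma sf_scal_theta f : sf_scal f * sf_theta = (0, gmon fset0 f).
Proof.
by apply: sfP; rewrite ?sfM1 ?sfM2 /=; rewrite !(mulr0, addr0, mulr1).
Qed.

Lemma sf_scal_theta_const J f : sf_scal f * sf_theta * sf_const J = (0, gmon J f).
Proof.
rewrite sf_scal_theta; apply: sfP; rewrite ?sfM1 ?sfM2 /=; first by rewrite mul0r.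
by rewrite mul0r add0r; apply: etrans (gmon_set0M J f 1) _; rewrite mulr1.
Qed.

(** Every superfunction is a sum of terms f a_J and f theta a_J. The constants a_J stand on the
    right, where [subst] and [gen_op] are linear over them. *)
Lemma sf_additive_ext (u v : sfun -> sfun) :
  {morph u : F G / F + G} -> {morph v : F G / F + G} ->
  (forall f J, u (sf_scal f * sf_const J) = v (sf_scal f * sf_const J)) ->
  (forall f J, u (sf_scal f * sf_theta * sf_const J) =
               v (sf_scal f * sf_theta * sf_const J)) ->
  u =1 v.
Proof.
move=> uD vD uv1 uv2 [x y].
have u0 : u 0 = 0 by apply: (addrI (u 0)); rewrite -uD !addr0.
have v0 : v 0 = 0 by apply: (addrI (v 0)); rewrite -vD !addr0.
have -> : (x, y) = (x, 0) + (0, y) :> sfun.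
  by apply: sfP; rewrite ?sfD1 ?sfD2 /= ?addr0 ?add0r.
rewrite uD vD; congr (_ + _).
  elim/grassmann_ind: x => [|x x' hx hx'|I a]; first exact: etrans u0 (esym v0).
    have -> : (x + x', 0) = (x, 0) + (x', 0) :> sfun.
      by apply: sfP; rewrite ?sfD1 ?sfD2 /= ?addr0.
    by rewrite uD vD hx hx'.
  by have := uv1 a I; rewrite sf_scal_const.
elim/grassmann_ind: y => [|y y' hy hy'|I a]; first exact: etrans u0 (esym v0).
  have -> : (0, y + y') = (0, y) + (0, y') :> sfun.
    by apply: sfP; rewrite ?sfD1 ?sfD2 /= ?addr0.
  by rewrite uD vD hy hy'.
by have := uv2 a I; rewrite sf_scal_theta_const.
Qed.
End SuperfunctionSupport.

(** * Substitutions *)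

Section Substitutions.
Variable R : realType.
Local Notation cinf := (cinf R).
Local Notation coef := (grassmann cinf).
Local Notation sfun := (superfun coef).
Local Notation D := (@cderiv R).
Local Notation d := (@gderiv R).
Local Notation half := (2^-1 : R[i]).
Local Notation par := (grassmann_parity cinf).
Implicit Types (x y z : coef) (I J : {fset nat}) (f g a b : cinf) (F G W Th : sfun).
Implicit Types (T : substitution R).

Lemma gderivD : {morph d : x y / x + y}.
Proof. exact: gmapD (@cderivD R). Qed.

Lemma gderiv_mon I a : d (gmon I a) = gmon I (D a).
Proof. exact: gmap_mon (@cderivD R) I a. Qed.

Lemma gderivM x y : d (x * y) = d x * y + x * d y.
Proof. exact: (gmap_derivM (@cderivD R) (@cderivM R) x y). Qed.

Lemma gsupp_gderiv P x : gsupp P x -> gsupp P (d x).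
Proof. by move=> Px; apply: (gsupp_gmap (@cderivD R)). Qed.

Lemma cderiv1 : D 1 = 0.
Proof. by rewrite -[1]scale1r cderiv_const. Qed.

Lemma cderiv0 : D 0 = 0.
Proof. exact: morphD0 (@cderivD R). Qed.

Lemma gderiv_const J : d (gmon J 1) = 0.
Proof. by rewrite gderiv_mon cderiv1 gmon0. Qed.

Definition taylor_coef n f : cinf := (n`!%:R : R[i])^-1 *: iter n D f.

Lemma taylor_coefD n : {morph taylor_coef n : f g / f + g}.
Proof.
move=> f g; rewrite /taylor_coef -scalerDr; congr (_ *: _).
by elim: n => //= n ->; rewrite cderivD.
Qed.

Lemma taylor_coef0 f : taylor_coef 0 f = f.
Proof. by rewrite /taylor_coef invr1 scale1r. Qed.

Lemma deriv_taylor_coef n f : D (taylor_coef n f) = taylor_coef n.+1 f *+ n.+1.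
Proof.
rewrite /taylor_coef cderivZ scalerMnl factS natrM invfM -[X in X *: _ = _]mul1r.
congr (_ *: _); rewrite -[RHS]mulr_natl mulrA.
by rewrite mulfV // pnatr_eq0.
Qed.

Lemma taylorE m f W : W ^+ m = 0 ->
  taylor f W = taylor_sum taylor_coef (@sf_scal cinf) m f W.
Proof.
move=> Wm; rewrite -[taylor f W]/(taylor_sum taylor_coef (@sf_scal cinf) _ f W).
(* Either the chosen bound q also satisfies W^q = 0, and the sums up to q and m agree, or no bound
   exists, contrary to the assumption on m. *)
case: xgetP => [q _ /= Wq|/(_ m)]; last by rewrite /= Wm.
case: (leqP m q) => [mq|/ltnW qm].
  exact: taylor_sum_le Wm mq.
exact/esym/(taylor_sum_le _ _ _ Wq qm).
Qed.

Lemma taylorD W : {morph (fun f => taylor f W) : f g / f + g}.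
Proof.
move=> f g; rewrite /taylor -big_split; apply: eq_bigr => n _ /=.
rewrite -mulrDl; congr (_ * _); rewrite -[RHS]sf_scalD.
by congr sf_scal; apply: taylor_coefD.
Qed.

Lemma sf_scal_even f : sf_even par (sf_scal f).
Proof.
by split; [apply: gsupp_mon; rewrite /even_set cardfs0|apply: gsupp0].
Qed.

Lemma taylor_sqr0 f W : W ^+ 2 = 0 -> taylor f W = sf_scal f + sf_scal (D f) * W.
Proof.
move=> W2; rewrite (taylorE _ W2).
exact: (taylor_sum_sqr0 (@sf_scal cinf) taylor_coef0 deriv_taylor_coef).
Qed.

Lemma taylor1 W m : W ^+ m = 0 -> taylor (1 : cinf) W = 1.
Proof.
move=> Wm; have Wm1 : W ^+ m.+1 = 0 by rewrite exprS Wm mulr0.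
rewrite (taylorE _ Wm1) /taylor_sum big_ord_recl big1 => [|n _].
  by rewrite expr0 mulr1 addr0 taylor_coef0.
rewrite /taylor_coef (_ : iter _ _ _ = 0) ?scaler0.
  by rewrite /sf_scal gmon0 mul0r.
by rewrite lift0; elim: (n : nat) => [|k ih]; rewrite iterS ?ih ?cderiv0 ?cderiv1.
Qed.

Definition subst_slot1 W I f : sfun := taylor f W * gconst R I.
Definition subst_slot2 W Th I f : sfun := taylor f W * Th * gconst R I.

Lemma subst_slot1D W I : {morph subst_slot1 W I : f g / f + g}.
Proof. by move=> f g; rewrite /subst_slot1 taylorD mulrDl. Qed.

Lemma subst_slot2D W Th I : {morph subst_slot2 W Th I : f g / f + g}.
Proof. by move=> f g; rewrite /subst_slot2 taylorD !mulrDl. Qed.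

Lemma substD T : {morph subst T : F G / F + G}.
Proof.
move=> F G; exact: etrans (congr2 +%R (glinD (subst_slot1D (sub_incr T)) F.1 G.1)
  (glinD (subst_slot2D (sub_incr T) (sub_theta T)) F.2 G.2)) (addrACA _ _ _ _).
Qed.

Lemma subst_const T f J :
  subst T (sf_scal f * sf_const cinf J) = taylor f (sub_incr T) * sf_const cinf J.
Proof.
apply: etrans (congr1 (subst T) (sf_scal_const J f)) _.
exact: etrans (congr2 +%R (glin_mon (subst_slot1D (sub_incr T)) J f)
  (glin0 (subst_slot2 (sub_incr T) (sub_theta T)))) (addr0 _).
Qed.

Lemma subst_theta_const T f J :
  subst T (sf_scal f * sf_theta cinf * sf_const cinf J) =
  taylor f (sub_incr T) * sub_theta T * sf_const cinf J.
Proof.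
apply: etrans (congr1 (subst T) (sf_scal_theta_const J f)) _.
exact: etrans (congr2 +%R (glin0 (subst_slot1 (sub_incr T)))
  (glin_mon (subst_slot2D (sub_incr T) (sub_theta T)) J f)) (add0r _).
Qed.

Section Generators.
Variables (I : {fset nat}) (a : cinf).
Hypothesis I0 : I != fset0.
Local Notation c := (gmon I a).
Local Notation k := (gmon I (half *: D a)).

Let Z x := exists b, x = gmon I b.
Let Zmon b : Z (gmon I b). Proof. by exists b. Qed.
Let Z0 : Z 0. Proof. by exists 0; rewrite gmon0. Qed.
Let Zd x : Z x -> Z (d x). Proof. by move=> [b ->]; exists (D b); apply:
  gderiv_mon. Qed.
Let ZZ x y z : Z x -> Z y -> x * z * y = 0.
Proof. by move=> [b ->] [b' ->]; apply: gmon_sandwich. Qed.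
Let kE : k + k = d c.
Proof.
rewrite gderiv_mon -gmonD -scalerDl.
have -> : half + half = 1 by rewrite -mulr2n -[LHS]mulr_natl mulfV ?pnatr_eq0.
by rewrite scale1r.
Qed.
Let ed x : ev par x -> ev par (d x). Proof. exact: gsupp_gderiv. Qed.
Let odd_d x : od par x -> od par (d x). Proof. exact: gsupp_gderiv. Qed.
Let emon b : ~~ odd #|` I| -> ev par (gmon I b).
Proof. exact: gsupp_mon. Qed.
Let omon b : odd #|` I| -> od par (gmon I b).
Proof. exact: gsupp_mon. Qed.

(** The parity of I decides between 1 + a_I L(a) and 1 + a_I M(a), so that one family covers both
    kinds of generators. *)
Definition gen_incr : sfun := if odd #|` I| then (0, c) else (c, 0).
Definition gen_theta : sfun := if odd #|` I| then (- c, 1) else (0, 1 + k).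
Definition gen_op (F : sfun) : sfun := if odd #|` I|
  then opM d c F else opL d c k F.
Definition gen_subst := Substitution gen_incr gen_theta.

Lemma gen_opD : {morph gen_op : F G / F + G}.
Proof.
move=> F G; rewrite /gen_op; case: (odd _); first exact: opMD gderivD _ _ _.
exact: opLD gderivD _ _ _ _.
Qed.

Lemma gen_opM F G : sf_even par F -> gen_op (F * G) = gen_op F * gen_op G.
Proof.
move=> eF; rewrite /gen_op; case: (boolP (odd _)) => oI.
  exact: (opMM gderivM ZZ (Zmon a) (omon oI) G eF).
exact: (opLM gderivD gderivM Z0 ZZ (Zmon _) (Zmon _) (emon oI) (emon oI)).
Qed.

Lemma gen_op_const F J : gen_op (F * sf_const cinf J) = gen_op F * sf_const cinf J.
Proof.
have dJ := gderiv_const J; rewrite /gen_op; case: (boolP (odd _)) => oI.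
  exact: (opM_const gderivM _ _ dJ).
exact: (opL_const gderivD gderivM Z0 ZZ (Zmon _) (Zmon _) (emon oI) (emon oI) _ dJ).
Qed.

Lemma gen_op_scal f : gen_op (sf_scal f) = sf_scal f + sf_scal (D f) * gen_incr.
Proof.
have ef : ev par (gmon fset0 f) by have [] := sf_scal_even f.
have -> : sf_scal (D f) = (d (gmon fset0 f), 0) by rewrite gderiv_mon.
rewrite /gen_op /gen_incr; case: (odd _).
  exact: (opM_scal ed c ef).
exact: (opL_scal gderivD ed _ _ ef).
Qed.

Lemma gen_op_theta : gen_op (sf_theta cinf) = gen_theta.
Proof.
rewrite /gen_op /gen_theta; case: (odd _); first exact: (opM_theta gderivD).
exact: (opL_theta gderivD gderivM).
Qed.

Lemma gen_op1 : gen_op 1 = 1.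
Proof.
rewrite /gen_op; case: (odd _); first exact: (opM1 gderivM).
exact: (opL1 gderivD gderivM).
Qed.

Lemma gen_op_even F : sf_even par F -> sf_even par (gen_op F).
Proof.
move=> eF; rewrite /gen_op; case: (boolP (odd _)) => oI.
  exact: (opM_even ed (omon oI) eF).
exact: (opL_even ed odd_d (emon oI) (emon oI) eF).
Qed.

Lemma gen_op_odd F : sf_odd par F -> sf_odd par (gen_op F).
Proof.
move=> eF; rewrite /gen_op; case: (boolP (odd _)) => oI.
  exact: (opM_odd odd_d (omon oI) eF).
exact: (opL_odd ed odd_d (emon oI) (emon oI) eF).
Qed.

Lemma gen_incr_even : sf_even par gen_incr.
Proof.
rewrite /gen_incr; case: (boolP (odd _)) => oI; split; try exact: gsupp0.
  exact: omon.
exact: emon.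
Qed.

Lemma gen_incr_sqr : gen_incr ^+ 2 = 0.
Proof.
have cc : c * c = 0 by rewrite -[X in X * _]mulr1; apply: gmon_sandwich.
rewrite expr2 /gen_incr; case: (odd _); apply: sfP; rewrite ?sfM1 ?sfM2 /=.
- exact: mulr0.
- by rewrite mulr0 mul0r addr0.
- exact: cc.
- by rewrite mulr0 mul0r addr0.
Qed.

Lemma gen_contact W Th : sf_odd par Th -> is_contact_pair d W Th ->
  is_contact_pair d (gen_incr + gen_op W) (gen_op Th).
Proof.
move=> oT cT; rewrite /gen_op /gen_incr; case: (boolP (odd _)) => oI.
  exact: (opM_contact gderivD gderivM odd_d Zd ZZ (Zmon a) (omon oI) oT cT).
exact: (opL_contact gderivD gderivM Zd Z0 ZZ (Zmon _) (Zmon _) (emon oI) (emon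
  oI) kE cT).
Qed.

(** The increment squares to 0, so Taylor expansion has two terms, which are those of the operator.
    It remains to compare the values on f a_J and f theta a_J. *)
Lemma subst_gen : subst gen_subst =1 gen_op.
Proof.
apply: sf_additive_ext => [||f J|f J]; [exact: substD|exact: gen_opD| |].
  by rewrite subst_const gen_op_const gen_op_scal taylor_sqr0 //; apply:
    gen_incr_sqr.
rewrite subst_theta_const gen_op_const gen_opM; last exact: sf_scal_even.
by rewrite gen_op_scal gen_op_theta taylor_sqr0 //; apply: gen_incr_sqr.
Qed.

Lemma gen_op_taylor f W : sf_even par W -> sf_supp (code_ge 1) W ->
  sf_supp (code_ge 1) (gen_incr + gen_op W) ->
  gen_op (taylor f W) = taylor f (gen_incr + gen_op W).
Proof.
move=> eW W1 EW1.
have [m1 h1] := sf_nilpotent W1; have [m3 h3] := sf_nilpotent EW1.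
have h2 : gen_op W ^+ m1 = 0.
  rewrite -(generatorX gen_opM gen_op1 _ eW) h1.
  by apply: (addrI (gen_op 0)); rewrite -gen_opD !addr0.
have nil (x : sfun) u v : x ^+ u = 0 -> x ^+ (u + v) = 0.
  by move=> xu; rewrite exprD xu mul0r.
(* One length that suffices for both Taylor sums, with the extra term that [taylor_sum_generator]
   asks for. *)
rewrite (@taylorE (m1 + m3).+1 _ W); last by rewrite -addnS nil.
rewrite (@taylorE (m1 + m3).+1 _ (_ + _)); last by rewrite addnC -addnS nil.
apply: (taylor_sum_generator deriv_taylor_coef (@sf_scalMn _) sf_scal_even
  gen_opD gen_opM gen_op_scal gen_op1 gen_op_even gen_incr_even gen_incr_sqr) => //.
exact: nil.
Qed.

(** Taylor expansions along an even increment are even. The operator of the generator is therefore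
    multiplicative on f(phi + W) times the image of theta. *)
Lemma subst_gen_comp T F : sf_even par (sub_incr T) ->
  sf_supp (code_ge 1) (sub_incr T) ->
  sf_supp (code_ge 1) (gen_incr + gen_op (sub_incr T)) ->
  subst (sub_comp gen_subst T) F = gen_op (subst T F).
Proof.
move=> eW W1 EW1; move: F.
have incrE : sub_incr (sub_comp gen_subst T) = gen_incr + gen_op (sub_incr T).
  by rewrite /= subst_gen.
have thetaE : sub_theta (sub_comp gen_subst T) = gen_op (sub_theta T).
  by rewrite /= subst_gen.
have eT f : sf_even par (taylor f (sub_incr T)).
  have [m /taylorE ->] := sf_nilpotent W1; rewrite /taylor_sum.
  elim/big_ind: _ => [|F G eF eG|n _]; first by split; apply: gsupp0.
    exact: sf_evenD.
  by apply: sf_evenM; [apply: sf_scal_even|apply: sf_evenX].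
apply: sf_additive_ext => [||f J|f J]; first exact: substD.
- by move=> F G; exact: etrans (congr1 gen_op (substD T F G)) (gen_opD _ _).
- rewrite !subst_const gen_op_const; congr (_ * _).
  by rewrite incrE (gen_op_taylor f eW W1 EW1).
rewrite !subst_theta_const gen_op_const; congr (_ * _).
rewrite incrE thetaE -(gen_op_taylor f eW W1 EW1).
exact: esym (gen_opM _ (eT f)).
Qed.

End Generators.
End Substitutions.

(** * Surplace contactomorphisms *)

(** The multiplier h can only be u, and theta u keeps just the first component of u. *)
Lemma theta_multiple (A : pzRingType) (u v : superfun A) :
  (exists h, u = h /\ v = ((0, 1) : superfun A) * h) <-> v.1 = 0 /\ v.2 = u.1.
Proof.
have thM h : ((0, 1) : superfun A) * h = (0, h.1).
  by apply: sfP; rewrite ?sfM1 ?sfM2 /= mul0r ?add0r ?mul1r.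
split=> [[h [-> ->]]|[v1 v2]]; first by rewrite thM.
by exists u; split=> //; rewrite thM; apply: sfP.
Qed.

Section SurplaceContact.
Variable R : realType.
Local Notation cinf := (cinf R).
Local Notation coef := (grassmann cinf).
Local Notation sfun := (superfun coef).
Local Notation D := (@cderiv R).
Local Notation d := (@gderiv R).
Local Notation half := (2^-1 : R[i]).
Local Notation par := (grassmann_parity cinf).
Local Notation th := (sf_theta cinf).
Implicit Types (x y z : coef) (I J : {fset nat}) (f g a b : cinf) (F G W Th : sfun).
Implicit Types (T : substitution R).

Definition sub_supp P T : Prop :=
  sf_supp P (sub_incr T) /\ sf_supp P (sub_theta T - th).

Lemma odd_code1 x : gsupp odd_set x -> gsupp (code_ge 1) x.
Proof.
move=> ox; apply/gsupp_code1/eqP; apply: contraT => /ox.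
by rewrite /odd_set cardfs0.
Qed.

Lemma sf_thetaB1 F : (F - th).1 = F.1. Proof. exact: subr0. Qed.
Lemma sf_thetaB2 F : (F - th).2 = F.2 - 1. Proof. by []. Qed.

(** The conditions at a_j = 0 say that T differs from the identity by terms of positive code; odd
    components have no constant term anyway. *)
Lemma surplace_diffeoE T : surplace_diffeo T <->
  [/\ sf_even par (sub_incr T), sf_odd par (sub_theta T) & sub_supp (code_ge 1) T].
Proof.
have one0 : (1 : coef)@_fset0 = 1 by apply: mcoeffUU.
split=> [[[e1 b1] o2 [e3 b3] o4]|[[e1 o2] [o4 e3] [[b1 _] []]]].
  split=> //; split; split; first exact/gsupp_code1.
  - exact: odd_code1.
  - by rewrite sf_thetaB1; apply: odd_code1.
  - rewrite sf_thetaB2; apply/gsupp_code1; rewrite mcoeffB one0.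
    by apply/eqP; rewrite subr_eq0; apply/eqP.
rewrite sf_thetaB2 => _ /gsupp_code1; rewrite mcoeffB one0 => /eqP.
rewrite subr_eq0 => /eqP b3.
by split=> //; split=> //; apply/gsupp_code1.
Qed.

Lemma subst1 T : sf_supp (code_ge 1) (sub_incr T) -> subst T 1 = 1.
Proof.
move=> /sf_nilpotent [m Wm].
have -> : (1 : sfun) = sf_scal 1 * sf_const cinf fset0 by rewrite sf_scal_const.
by rewrite subst_const (taylor1 Wm) mul1r.
Qed.

Lemma subst_theta T : sf_supp (code_ge 1) (sub_incr T) -> subst T th = sub_theta T.
Proof.
move=> /sf_nilpotent [m Wm].
have -> : th = sf_scal 1 * th * sf_const cinf fset0 by rewrite sf_scal_theta_const.
rewrite subst_theta_const (taylor1 Wm) mul1r.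
exact: mulr1.
Qed.

Lemma is_contactE T : sf_supp (code_ge 1) (sub_incr T) ->
  is_contact T <-> is_contact_pair d (sub_incr T) (sub_theta T).
Proof.
move=> W1; rewrite /is_contact /is_contact_pair.
have O1 : (Omega R).1 = 1 by apply: etrans (congr1 _ (mul0r _)) (addr0 _).
have O2 : (Omega R).2 = th by apply: etrans (congr1 _ (mul1r _)) (add0r _).
have P1 : (pullback T (Omega R)).1.1 =
    1 + d (sub_incr T).1 + d (sub_theta T).1 * (sub_theta T).1.
  rewrite /pullback O1 O2 (subst1 W1) (subst_theta W1).
  exact: (congr1 (fun x : coef => x + d (sub_theta T).1 * (sub_theta T).1)
    (mulr1 (1 + d (sub_incr T).1))).
have P2 : (pullback T (Omega R)).2 =
    d_theta (sub_incr T) + d_theta (sub_theta T) * sub_theta T.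
  rewrite /pullback O1 O2 (subst1 W1) (subst_theta W1).
  exact: (congr1 (fun F : sfun => F + d_theta (sub_theta T) * sub_theta T)
    (etrans (mulr1 _) (add0r _))).
have P21 : (pullback T (Omega R)).2.1 =
    (sub_incr T).2 + (sub_theta T).2 * (sub_theta T).1 by rewrite P2.
have P22 : (pullback T (Omega R)).2.2 = (sub_theta T).2 * (sub_theta T).2.
  rewrite P2; apply: etrans (add0r _) _.
  by apply: etrans (congr1 _ (mul0r _)) (addr0 _).
rewrite -P21 -P22 -P1; move: (pullback T _) => [u v].
have -> : (exists h, (u, v) = form_mul (Omega R) h) <->
    (exists h, u = h /\ v = th * h).
  split=> [[h]|[h [-> ->]]]; rewrite /form_mul O1 O2.
    by case=> -> ->; exists h; split; first exact: mul1r.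
  by exists h; rewrite mul1r.
exact: theta_multiple.
Qed.

Definition contact_data T : Prop :=
  [/\ sf_even par (sub_incr T), sf_odd par (sub_theta T), sub_supp (code_ge 1) T &
      is_contact_pair d (sub_incr T) (sub_theta T)].

Lemma SContE T : SCont T <-> contact_data T.
Proof.
split=> [[/surplace_diffeoE[eW oT T1] cT]|[eW oT T1 cT]].
  by split=> //; apply/is_contactE => //; case: T1.
by split; [apply/surplace_diffeoE|apply/is_contactE => //; case: T1].
Qed.

Section Generator.
Variables (I : {fset nat}) (a : cinf).
Hypothesis I0 : I != fset0.
Local Notation E := (gen_op I a).

Lemma gsupp_gmonM (P Q : {fset nat} -> Prop) b x :
  (forall J, [disjoint I & J]%fset -> P J -> Q (I `|` J)%fset) ->
  gsupp P x -> gsupp Q (gmon I b * x).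
Proof.
move=> PQ; apply: (@gsuppM _ (eq^~ I)); last exact: gsupp_mon.
by move=> J K + eJ; rewrite eJ; apply: PQ.
Qed.

(** A generator changes F only by multiples of a_I, so the indices of the change are disjoint unions
    of I with indices of F. This controls both the codes and the a_j that occur. *)
Lemma gen_op_supp (P Q : {fset nat} -> Prop) F :
  (forall J, [disjoint I & J]%fset -> P J -> Q (I `|` J)%fset) ->
  sf_supp P F -> sf_supp Q (E F - F).
Proof.
move=> PQ [P1 P2]; have c b x : gsupp P x -> gsupp Q (gmon I b * x).
  exact: gsupp_gmonM.
have dc b x : gsupp P x -> gsupp Q (gmon I b * d x).
  by move=> Px; apply: c; apply: gsupp_gderiv.
have sub (x y : coef) : x + y - x = y by rewrite addrC addKr.
rewrite /gen_op; case: (odd _); split.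
- rewrite -[(_ - _).1]/(F.1 - gmon I a * F.2 - F.1) sub.
  by apply: gsuppN; apply: c.
- rewrite -[(_ - _).2]/(F.2 + gmon I a * d F.1 - F.2) sub; exact: dc.
- rewrite -[(_ - _).1]/(F.1 + gmon I a * d F.1 + 0 * F.1 - F.1) -addrA mul0r add0r.
  by rewrite addrAC subrr add0r; apply: dc.
rewrite -[(_ - _).2]/(F.2 + gmon I a * d F.2 + gmon I (half *: D a) * F.2 - F.2).
by rewrite -(addrA F.2) sub; apply: gsuppD; [apply: dc|apply: c].
Qed.

Lemma gen_theta_supp (P : {fset nat} -> Prop) : P I ->
  sf_supp P (gen_theta I a - th).
Proof.
move=> PI; rewrite /gen_theta; case: (odd _); split.
- by rewrite sf_thetaB1 /=; apply: gsuppN; apply: gsupp_mon.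
- by rewrite sf_thetaB2 /= subrr; apply: gsupp0.
- by rewrite sf_thetaB1; apply: gsupp0.
- by rewrite sf_thetaB2 /= addrC addKr; apply: gsupp_mon.
Qed.

Lemma gen_incr_supp (P : {fset nat} -> Prop) : P I -> sf_supp P (gen_incr I a).
Proof.
move=> PI; rewrite /gen_incr; case: (odd _); split; try exact: gsupp0.
  exact: gsupp_mon.
exact: gsupp_mon.
Qed.

(** Composition with a generator on the left, in terms of [gen_op] and hence without Taylor sums;
    [gen_compE] identifies it with [sub_comp]. *)
Definition gen_comp T :=
  Substitution (gen_incr I a + E (sub_incr T)) (E (sub_theta T)).

Lemma gen_compE T : sub_comp (gen_subst I a) T = gen_comp T.
Proof. by rewrite /sub_comp /gen_comp !(subst_gen _ I0). Qed.

Lemma gen_op_thetaB F :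
  E F - th = E (F - th) - (F - th) + (F - th + (gen_theta I a - th)).
Proof.
rewrite addrA subrK addrA -(gen_op_theta I a) -(gen_opD I a).
by rewrite subrK.
Qed.

Lemma gen_comp_supp (P : {fset nat} -> Prop) T : P I ->
  (forall J, [disjoint I & J]%fset -> P J -> P (I `|` J)%fset) ->
  sub_supp P T -> sub_supp P (gen_comp T).
Proof.
move=> PI PU [P1 P2]; split; rewrite /=.
  apply: sf_suppD; first exact: gen_incr_supp.
  rewrite -[E _](subrK (sub_incr T)); apply: sf_suppD => //.
  exact: gen_op_supp PU P1.
rewrite gen_op_thetaB; apply: sf_suppD; first exact: gen_op_supp PU P2.
exact: sf_suppD P2 (gen_theta_supp PI).
Qed.

Lemma gen_comp_code k T : (k <= fcode I)%N -> sub_supp (code_ge k) T ->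
  sub_supp (code_ge k) (gen_comp T).
Proof.
move=> kI; apply: gen_comp_supp => // J dIJ kJ.
by rewrite /code_ge fcodeU // (leq_trans kI) ?leq_addr.
Qed.

Lemma fcode_gt0 : (0 < fcode I)%N.
Proof. by rewrite lt0n fcode_eq0. Qed.

Lemma gen_comp_contact T : contact_data T -> contact_data (gen_comp T).
Proof.
move=> [eW oT T1 cT]; split; rewrite /=.
- apply: sf_evenD; first exact: gen_incr_even.
  exact: gen_op_even.
- exact: gen_op_odd.
- by apply: gen_comp_code => //; apply: fcode_gt0.
exact: gen_contact.
Qed.
End Generator.

End SurplaceContact.

(** * Leading terms of contactomorphisms *)

Section LeadingTerm.
Variable R : realType.
Local Notation cinf := (cinf R).
Local Notation coef := (grassmann cinf).
Local Notation sfun := (superfun coef).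
Local Notation D := (@cderiv R).
Local Notation d := (@gderiv R).
Local Notation half := (2^-1 : R[i]).
Implicit Types (x y z : coef) (I J : {fset nat}) (f g a b : cinf) (F G W Th : sfun).
Implicit Types (T : substitution R).

Section Inverse.
Variables (I : {fset nat}) (a : cinf).
Hypothesis I0 : I != fset0.

Lemma gmonN J b : gmon J (- b) = - gmon J b.
Proof. exact: monalgUN. Qed.

Lemma cderivN b : D (- b) = - D b.
Proof. exact: (morphD_opp (@cderivD R)). Qed.

Let Z x := exists b, x = gmon I b.
Let Zmon b : Z (gmon I b). Proof. by exists b. Qed.
Let Z0 : Z 0. Proof. by exists 0; rewrite gmon0. Qed.
Let Zd x : Z x -> Z (d x). Proof. by move=> [b ->]; exists (D b); apply:
  gderiv_mon. Qed.
Let ZZ x y z : Z x -> Z y -> x * z * y = 0.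
Proof. by move=> [b ->] [b' ->]; apply: gmon_sandwich. Qed.

Lemma gen_opNK F : gen_op I a (gen_op I (- a) F) = F.
Proof.
rewrite /gen_op cderivN scalerN !gmonN; case: (odd _).
  exact: (opMNK (@gderivD R) (@gderivM R) Zd ZZ F (Zmon a)).
exact: (opLNK (@gderivD R) (@gderivM R) Zd Z0 ZZ F (Zmon a) (Zmon _)).
Qed.

Lemma gen_incrN : gen_op I a (gen_incr I (- a)) = - gen_incr I a.
Proof.
have cc b : gmon I a * gmon I b = 0.
  by rewrite -[X in X * _]mulr1; apply: gmon_sandwich.
have d0 : d 0 = 0 by exact: gmap0.
rewrite /gen_op /gen_incr; case: (odd _); apply: sfP => /=.
- by rewrite cc subr0 oppr0.
- by rewrite d0 mulr0 addr0 gmonN.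
- by rewrite /dens gderiv_mon cc mul0r !addr0 gmonN.
by rewrite /dens d0 !mulr0 !addr0 oppr0.
Qed.

Lemma gen_compNK T : gen_comp I a (gen_comp I (- a) T) = T.
Proof.
case: T => W Th; rewrite /gen_comp /=; congr Substitution; last exact: gen_opNK.
by rewrite (gen_opD I a) gen_incrN gen_opNK addrA subrr add0r.
Qed.
End Inverse.

Lemma gsupp_codeS k I x : gsupp (code_ge k) x -> fcode I = k -> x@_I = 0 ->
  gsupp (code_ge k.+1) x.
Proof.
move=> xk Ik xI J xJ; rewrite /code_ge ltn_neqAle xk // andbT -Ik.
by apply: contraNneq xJ => /fcode_inj <-; rewrite xI.
Qed.

Lemma gsupp_codeM0 k I x y : (0 < k)%N -> fcode I = k ->
  gsupp (code_ge k) x -> gsupp (code_ge k) y -> (x * y)@_I = 0.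
Proof.
by move=> k0 Ik xk yk; apply: gsupp_coef0 (gsuppM_code xk yk) _; lia.
Qed.

Lemma parity_coef0 x I : (gsupp even_set x /\ odd #|` I|) \/
  (gsupp odd_set x /\ ~~ odd #|` I|) -> x@_I = 0.
Proof.
move=> [[px oI]|[px oI]]; apply/eqP; apply: contraT => /px.
  by rewrite /even_set oI.
by rewrite /odd_set (negbTE oI).
Qed.

(** The increment is even, so at I only the component chosen here can be nonzero. *)
Definition leading_coef T I : cinf :=
  if odd #|` I| then (sub_incr T).2@_I else (sub_incr T).1@_I.

(** Products of two terms of code at least k > 0 have code at least 2k and do not reach I. The
    contact equations thus become linear at I, and they determine the image of theta there from the
    increment. *)
Lemma leading_contact T k I : (0 < k)%N -> contact_data T ->
  sub_supp (code_ge k) T -> fcode I = k ->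
  (sub_theta T).1@_I = - (sub_incr T).2@_I /\
  ((sub_theta T).2 - 1)@_I = half *: D (sub_incr T).1@_I.
Proof.
move=> k0 [_ _ _ [c1 c2]] [[Ak Bk] [rk uk]] Ik.
rewrite sf_thetaB1 in rk; rewrite sf_thetaB2 in uk.
have I0 : I != fset0 by rewrite -fcode_eq0 Ik -lt0n.
move: c1 c2; set u := (sub_theta T).2 - 1 in uk *; set r := (sub_theta T).1 in rk *.
have -> : (sub_theta T).2 = 1 + u by rewrite addrC subrK.
move: u r uk rk (sub_incr T) Ak Bk => u r uk rk [A B] /= Ak Bk c1 c2.
have c0 x y : gsupp (code_ge k) x -> gsupp (code_ge k) y -> (x * y)@_I = 0.
  exact: gsupp_codeM0.
split.
  apply/eqP; rewrite -addr_eq0 addrC.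
  have := congr1 (mcoeff I) c1; rewrite mulrDl mul1r !mcoeffD c0 // addr0 mcoeff0.
  by move=> ->.
have c2' : u + (u + u * u) = d A + d r * r.
  by apply: (addrI 1); rewrite addrA [RHS]addrA -c2 mulrDl mul1r mulrDr mulr1.
have := congr1 (mcoeff I) c2'; rewrite !mcoeffD (c0 u u) //.
rewrite (c0 (d r) r) //; last exact: gsupp_gderiv.
rewrite !addr0.
rewrite -[(d A)@_I]/((gmap D A)@_I) (gmapE (@cderivD R)) => <- /=.
rewrite scalerDr -scalerDl.
have -> : half + half = 1 by rewrite -mulr2n -[LHS]mulr_natl mulfV ?pnatr_eq0.
by rewrite scale1r.
Qed.

(** By [leading_contact], all the coefficients at I are those of one generator, and its inverse
    cancels them. The other changes are multiples of a_I by terms of positive code and lie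
    higher. *)
Lemma leading_step T k I : (0 < k)%N -> contact_data T ->
  sub_supp (code_ge k) T -> fcode I = k ->
  sub_supp (code_ge k.+1) (gen_comp I (- leading_coef T I) T).
Proof.
move=> k0 cT Tk Ik; have [rI uI] := leading_contact k0 cT Tk Ik.
have I0 : I != fset0 by rewrite -fcode_eq0 Ik -lt0n.
set b := - leading_coef T I.
have high J : [disjoint I & J]%fset -> code_ge k J -> code_ge k.+1 (I `|` J)%fset.
  by rewrite /code_ge => dIJ kJ; rewrite fcodeU //; lia.
have kI : code_ge k I by rewrite /code_ge Ik.
have [Wk thk] := Tk; have [[eA oB] [or eq] _ _] := cT.
have step F : sf_supp (code_ge k) F -> F.1@_I = 0 -> F.2@_I = 0 ->
    sf_supp (code_ge k.+1) F.
  by move=> [F1 F2] F1I F2I; split; apply: gsupp_codeS Ik _.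
have [gk gthk] := (gen_incr_supp b kI, gen_theta_supp b kI).
split.
  rewrite /gen_comp /= -[gen_op I b _](subrK (sub_incr T)) addrCA.
  apply: sf_suppD; first exact: gen_op_supp high Wk.
  apply: step; first exact: sf_suppD gk Wk.
    rewrite sfD1 mcoeffD /gen_incr /b /leading_coef; case: (boolP (odd _)) => oI /=.
      by rewrite mcoeff0 add0r; apply: parity_coef0; left.
    by rewrite mcoeffUU addNr.
  rewrite sfD2 mcoeffD /gen_incr /b /leading_coef; case: (boolP (odd _)) => oI /=.
    by rewrite mcoeffUU addNr.
  by rewrite mcoeff0 add0r; apply: parity_coef0; right.
rewrite /gen_comp /= gen_op_thetaB.
apply: sf_suppD; first exact: gen_op_supp high thk.
apply: step; first exact: sf_suppD thk gthk.
  rewrite sfD1 !sf_thetaB1 mcoeffD rI /gen_theta /b /leading_coef.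
  case: (boolP (odd _)) => oI /=; first by rewrite mcoeffN mcoeffUU opprK addNr.
  by rewrite mcoeff0 addr0 -rI; apply: parity_coef0; right.
rewrite sfD2 !sf_thetaB2 mcoeffD uI /gen_theta /b /leading_coef.
case: (boolP (odd _)) => oI /=.
  rewrite subrr mcoeff0 addr0 -uI; apply: parity_coef0; left; split=> //.
  by apply: gsuppB => //; apply: gsupp_even1.
rewrite [1 + _]addrC addrK mcoeffUU cderivN scalerN; exact: subrr.
Qed.

End LeadingTerm.

(** * Representations of the enveloping algebra *)

Section EnvelopingGenerators.
Variables (K : numFieldType) (g : lieSuperalgebra K).
Local Notation tensor := {malg K[{fmonom (lie0 g + lie1 g)%type}]}.
Local Notation env := (env g).

Lemma env_pi0 : env_pi (0 : tensor) = 0 :> env.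
Proof. by apply: (addrI (env_pi 0)); rewrite -env_piD !addr0. Qed.

Lemma env_piN (t : tensor) : env_pi (- t) = - env_pi t :> env.
Proof. by apply/eqP; rewrite -addr_eq0 -env_piD addNr env_pi0. Qed.

Lemma env_pi_mul (t u : tensor) : env_pi (t * u) = env_pi t * env_pi u :> env.
Proof. exact/esym/env_piM. Qed.

Lemma env_pi_scale k (t : tensor) : env_pi (k *: t) = k *: env_pi t :> env.
Proof. exact/esym/env_piZ. Qed.

Lemma env_pi_rel (t : tensor) : env_rel t -> env_pi t = 0 :> env.
Proof. by move=> rt; rewrite -env_pi0; apply/env_piP; rewrite subr0; apply:
  env_ideal_rel. Qed.

Lemma ienv0_linear : linear (@ienv0 K g).
Proof.
move=> k x y; apply/eqP; rewrite -subr_eq0; apply/eqP.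
by rewrite /ienv0 -env_pi_scale -env_piD -env_piN -env_piD
  (env_pi_rel (env_lin0 k x y)).
Qed.

Lemma ienv1_linear : linear (@ienv1 K g).
Proof.
move=> k x y; apply/eqP; rewrite -subr_eq0; apply/eqP.
by rewrite /ienv1 -env_pi_scale -env_piD -env_piN -env_piD
  (env_pi_rel (env_lin1 k x y)).
Qed.

Lemma ienv_br00 (x y : lie0 g) :
  ienv0 x * ienv0 y = ienv0 y * ienv0 x + ienv0 (br00 x y).
Proof.
apply/eqP; rewrite -subr_eq0 opprD addrA; apply/eqP.
by rewrite /ienv0 -!env_pi_mul -!env_piN -!env_piD (env_pi_rel (env_br00 x y)).
Qed.

Lemma ienv_br01 (x : lie0 g) (u : lie1 g) :
  ienv0 x * ienv1 u = ienv1 u * ienv0 x + ienv1 (br01 x u).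
Proof.
apply/eqP; rewrite -subr_eq0 opprD addrA; apply/eqP.
by rewrite /ienv0 /ienv1 -!env_pi_mul -!env_piN -!env_piD
  (env_pi_rel (env_br01 x u)).
Qed.

Lemma ienv_br11 (u v : lie1 g) :
  ienv1 u * ienv1 v = - (ienv1 v * ienv1 u) + ienv0 (br11 u v).
Proof.
apply/eqP; rewrite -subr_eq0 opprD opprK addrA; apply/eqP.
by rewrite /ienv0 /ienv1 -!env_pi_mul -!env_piN -!env_piD
  (env_pi_rel (env_br11 u v)).
Qed.

Lemma ienv1N (u : lie1 g) : ienv1 (- u) = - ienv1 u.
Proof.
have D v w : ienv1 (v + w) = ienv1 v + ienv1 w :> env.
  by have := ienv1_linear 1 v w; rewrite !scale1r.
have e0 : ienv1 (0 : lie1 g) = 0 :> env.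
  by apply: (addrI (ienv1 0)); rewrite -D !addr0.
by apply/eqP; rewrite -addr_eq0 -D addNr e0.
Qed.

Lemma ienv_br10 (u : lie1 g) (x : lie0 g) :
  ienv1 u * ienv0 x = ienv0 x * ienv1 u + ienv1 (- br01 x u).
Proof. by rewrite ienv1N ienv_br01 addrK. Qed.
End EnvelopingGenerators.

Section Representation.
Variables (K : numFieldType) (g : lieSuperalgebra K) (V : lmodType K).
Variables (op0 : lie0 g -> V -> V) (op1 : lie1 g -> V -> V).
Hypothesis op0_linear : forall x, linear (op0 x).
Hypothesis op1_linear : forall u, linear (op1 u).
Hypothesis op0_linearl : forall v, linear (op0^~ v).
Hypothesis op1_linearl : forall v, linear (op1^~ v).
Hypothesis op00 : forall x y v,
  op0 x (op0 y v) - op0 y (op0 x v) = op0 (br00 x y) v.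
Hypothesis op01 : forall x u v,
  op0 x (op1 u v) - op1 u (op0 x v) = op1 (br01 x u) v.
Hypothesis op11 : forall u u' v,
  op1 u (op1 u' v) + op1 u' (op1 u v) = op0 (br11 u u') v.
Local Notation tensor := {malg K[{fmonom (lie0 g + lie1 g)%type}]}.
Implicit Types (t r : tensor) (v w : V).

Definition act_gen (s : lie0 g + lie1 g) v :=
  match s with inl x => op0 x v | inr u => op1 u v end.
Definition act_word (s : seq (lie0 g + lie1 g)) v := foldr act_gen v s.
Definition act_tensor t v := \sum_(m <- msupp t) t@_m *: act_word m v.

Lemma act_word_linear s : linear (act_word s).
Proof.
move=> k v w; elim: s => //= a s ->.
by case: a => [x|u]; rewrite /= ?op0_linear ?op1_linear.
Qed.

Lemma act_tensorw (d : {fset {fmonom (lie0 g + lie1 g)%type}}) t v :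
  (msupp t `<=` d)%fset -> act_tensor t v = \sum_(m <- d) t@_m *: act_word m v.
Proof.
move=> sd; apply: big_fset_incl => // m _.
by rewrite -mcoeff_eq0 => /eqP ->; rewrite scale0r.
Qed.

Lemma act_tensor_linearl v : linear (act_tensor^~ v).
Proof.
move=> k t r; pose d := (msupp t `|` msupp r)%fset.
rewrite (@act_tensorw d t) ?fsubsetUl // (@act_tensorw d r) ?fsubsetUr //.
rewrite (@act_tensorw d); last first.
  by apply: fsubset_trans (msuppD_le _ _) _; apply: fsetSU; apply: msuppZ_le.
rewrite scaler_sumr -big_split; apply: eq_bigr => m _ /=.
by rewrite mcoeffD mcoeffZ scalerDl scalerA.
Qed.

Lemma act_tensorD t r v : act_tensor (t + r) v = act_tensor t v + act_tensor r v.
Proof. by rewrite -{1}[t]scale1r act_tensor_linearl scale1r. Qed.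

Lemma act_tensor0 v : act_tensor 0 v = 0.
Proof. by rewrite /act_tensor msupp0 big_seq_fset0. Qed.

Lemma act_tensorN t v : act_tensor (- t) v = - act_tensor t v.
Proof. by apply/eqP; rewrite -addr_eq0 -act_tensorD addNr act_tensor0. Qed.

Lemma act_tensorU k m v : act_tensor << k *g m >> v = k *: act_word m v.
Proof.
by rewrite (@act_tensorw [fset m]%fset) ?msuppU_le // big_seq_fset1 mcoeffUU.
Qed.

Lemma act_tensor_sum (T : Type) (s : seq T) (F : T -> tensor) v :
  act_tensor (\sum_(i <- s) F i) v = \sum_(i <- s) act_tensor (F i) v.
Proof.
by apply: (big_morph (act_tensor^~ v)) => [t r|]; rewrite ?act_tensorD ?act_tensor0.
Qed.

Lemma act_wordZ s k v : act_word s (k *: v) = k *: act_word s v.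
Proof.
have w0 : act_word s 0 = 0.
  have := act_word_linear s 1 0 0; rewrite !scale1r addr0 => e.
  by apply: (addrI (act_word s 0)); rewrite -e addr0.
by rewrite -[k *: v]addr0 act_word_linear w0 addr0.
Qed.

Lemma act_word_sum s (T : Type) (r : seq T) (F : T -> V) :
  act_word s (\sum_(i <- r) F i) = \sum_(i <- r) act_word s (F i).
Proof.
apply: (big_morph (act_word s)) => [v w|]; last by have := act_wordZ s 0 0;
  rewrite !scale0r.
by rewrite -{1}[v]scale1r act_word_linear scale1r.
Qed.

Lemma act_tensorM t r v : act_tensor (t * r) v = act_tensor t (act_tensor r v).
Proof.
rewrite malgME act_tensor_sum [RHS]/act_tensor; apply: eq_bigr => m _.
rewrite act_tensor_sum [in RHS]/act_tensor act_word_sum scaler_sumr.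
apply: eq_bigr => m' _; rewrite act_tensorU act_wordZ scalerA; congr (_ *: _).
by rewrite /act_word fmM foldr_cat.
Qed.

Lemma act_lin k t r s v :
  act_tensor (s - (k *: t + r)) v =
  act_tensor s v - (k *: act_tensor t v + act_tensor r v).
Proof. by rewrite act_tensorD act_tensorN act_tensor_linearl. Qed.

Lemma act_comm t r s v : act_tensor (t * r - r * t - s) v =
  act_tensor t (act_tensor r v) - act_tensor r (act_tensor t v) - act_tensor s v.
Proof.
rewrite -!act_tensorM; move: (t * r) (r * t) => p q.
by rewrite !act_tensorD !act_tensorN.
Qed.

Lemma act_acomm t r s v : act_tensor (t * r + r * t - s) v =
  act_tensor t (act_tensor r v) + act_tensor r (act_tensor t v) - act_tensor s v.
Proof.
rewrite -!act_tensorM; move: (t * r) (r * t) => p q.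
by rewrite !act_tensorD !act_tensorN.
Qed.

Lemma act_tgen0 x v : act_tensor (tgen0 x) v = op0 x v.
Proof. by rewrite act_tensorU scale1r fmU. Qed.

Lemma act_tgen1 u v : act_tensor (tgen1 u) v = op1 u v.
Proof. by rewrite act_tensorU scale1r fmU. Qed.

Lemma act_tensor1 v : act_tensor 1 v = v.
Proof. by rewrite act_tensorU scale1r fm1. Qed.

(** The defining relations act by 0 by the assumptions on [op0] and [op1]. Multiples on either side
    do so too, because products act as compositions of linear maps. *)
Lemma act_ideal t v : env_ideal t -> act_tensor t v = 0.
Proof.
move=> it; elim: it v => [{}t rt|v|r s _ hr _ hs v|s r _ h v|s r _ h v].
- case: rt => [k x y|k u u'|x y|x u|u u'] v.
  + by rewrite act_lin !act_tgen0 op0_linearl subrr.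
  + by rewrite act_lin !act_tgen1 op1_linearl subrr.
  + by rewrite act_comm !act_tgen0 op00 subrr.
  + by rewrite act_comm !act_tgen0 !act_tgen1 op01 subrr.
  + by rewrite act_acomm !act_tgen0 !act_tgen1 op11 subrr.
- exact: act_tensor0.
- by rewrite act_tensorD hr hs addr0.
- rewrite act_tensorM h /act_tensor big1 // => m _.
  by rewrite -(scale0r 0) act_wordZ !scale0r scaler0.
- by rewrite act_tensorM h.
Qed.

Definition act_env (x : env g) v := act_tensor (env_repr x) v.

Lemma act_env_pi t v : act_env (env_pi t) v = act_tensor t v.
Proof.
apply/eqP; rewrite -subr_eq0 /act_env -act_tensorN -act_tensorD; apply/eqP.
by rewrite -opprB act_tensorN act_ideal ?oppr0 //; apply: env_reprP.
Qed.

Lemma act_envD x y v : act_env (x + y) v = act_env x v + act_env y v.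
Proof.
elim/env_ind: x => t; elim/env_ind: y => r.
by rewrite -env_piD !act_env_pi act_tensorD.
Qed.

Lemma act_envM x y v : act_env (x * y) v = act_env x (act_env y v).
Proof.
elim/env_ind: x => t; elim/env_ind: y => r.
by rewrite -env_pi_mul !act_env_pi act_tensorM.
Qed.

Lemma act_env1 v : act_env 1 v = v.
Proof. by rewrite -[1]/(env_pi 1) act_env_pi act_tensor1. Qed.

Lemma act_ienv0 x v : act_env (ienv0 x) v = op0 x v.
Proof. by rewrite act_env_pi act_tgen0. Qed.

Lemma act_ienv1 u v : act_env (ienv1 u) v = op1 u v.
Proof. by rewrite act_env_pi act_tgen1. Qed.
End Representation.

(** * The natural homomorphism *)

(** Lifts a formula for f(u v) to Grassmann coefficients. Two terms on the right suffice, since each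
    component of L(a) or M(b) applied to a jet has at most two. *)
Lemma gmap_gmonM (S T : pzRingType) (f h h' : S -> T) (u : S) (b b' : T) I y :
  {morph f : a c / a + c} -> {morph h : a c / a + c} -> {morph h' : a c / a + c} ->
  (forall v, f (u * v) = b * h v + b' * h' v) ->
  gmap f (gmon I u * y) = gmon I b * gmap h y + gmon I b' * gmap h' y.
Proof.
move=> fD hD h'D fu; elim/grassmann_ind: y => [|y y' ih ih'|J v].
- by rewrite !mulr0 !gmap0 !mulr0 addr0.
- apply: etrans (congr1 (gmap f) (mulrDr _ _ _)) _; apply: etrans (gmapD fD _ _) _.
  apply: etrans (congr2 +%R ih ih') _; apply: etrans (addrACA _ _ _ _) _.
  by rewrite (gmapD hD) (gmapD h'D) -2!mulrDr.
apply: etrans (congr1 (gmap f) (gmonM I J u v)) _.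
have -> : gmap f (gmulU I J u v) = gmulU I J b (h v) + gmulU I J b' (h' v).
  rewrite /gmulU; case: (boolP [disjoint I & J]%fset) => _;
    last by rewrite gmap0 addr0.
  by rewrite (gmap_mon fD) -gmonD -mulrDr -fu (morphD_signM fD).
rewrite (gmap_mon hD) (gmap_mon h'D).
exact: (congr2 +%R (esym (gmonM I J b (h v))) (esym (gmonM I J b' (h' v)))).
Qed.

Section NaturalMap.
Variable R : realType.
Local Notation cinf := (cinf R).
Local Notation coef := (grassmann cinf).
Local Notation sfun := (superfun coef).
Local Notation D := (@cderiv R).
Local Notation d := (@gderiv R).
Local Notation half := (2^-1 : R[i]).
Local Notation th := (sf_theta cinf).
Local Notation g := (cont R).
Local Notation env := (env g).
Implicit Types (I J : {fset nat}) (a b f : cinf).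

(* The coordinate phi is not a function on the circle: the last summand of     *)
(* [jet] is spanned by it.                                                     *)
Definition jet : lmodType R[i] := ((cinf * cinf) * R[i]^o)%type.
Implicit Types v : jet.

(** The jet v is a superfunction plus [v.2] times phi; the added terms are L(a) phi = a and M(b) phi
    = b theta. *)
Definition jetL a v : jet := (vfL a v.1 + (v.2 *: a, 0), 0).
Definition jetM b v : jet := (vfM b v.1 + (0, v.2 *: b), 0).

Lemma jetP v v' : v.1.1 = v'.1.1 -> v.1.2 = v'.1.2 -> v.2 = v'.2 -> v = v'.
Proof. by case: v v' => [[? ?] ?] [[? ?] ?] /= -> -> ->. Qed.

(** Scalars are turned into constant functions, so that [ring] can work within the functions on the
    circle. *)
Definition cinf_cst (k : R[i]) : cinf := k%:A.
Local Notation C := cinf_cst.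
Local Notation h := (C half).

Let hh : h + h = 1.
Proof.
rewrite /C -scalerDl -mulr2n -[_ *+ 2]mulr_natl mulfV ?pnatr_eq0 //.
by rewrite scale1r.
Qed.
Let ZE (k : R[i]) (f : cinf) : k *: f = C k * f. Proof. by rewrite mulr_algl. Qed.
Let CE (k u w : R[i]) : C (k * u + w) = C k * C u + C w.
Proof. by rewrite /C scalerDl -scalerA ZE. Qed.
Let C0 : C 0 = 0. Proof. exact: scale0r. Qed.
Let DE := (@cderivD R, @cderivM R, morphD_opp (@cderivD R), morphD0 (@cderivD R),
  fun k => cderiv_const k : D (C k) = 0).

Ltac jet_ring := rewrite /= ?/cont_br00 ?/cont_br01 !(ZE, DE, CE, C0); ring.

Lemma jetL_linear a : linear (jetL a).
Proof.
move=> k v w; apply: jetP; [jet_ring|jet_ring|by rewrite /= scaler0 addr0].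
Qed.

Lemma jetM_linear b : linear (jetM b).
Proof.
move=> k v w; apply: jetP; [jet_ring|jet_ring|by rewrite /= scaler0 addr0].
Qed.

Lemma jetL_linearl v : linear (jetL^~ v).
Proof.
move=> k a c; apply: jetP; [jet_ring|jet_ring|by rewrite /= scaler0 addr0].
Qed.

Lemma jetM_linearl v : linear (jetM^~ v).
Proof.
move=> k a c; apply: jetP; [jet_ring|jet_ring|by rewrite /= scaler0 addr0].
Qed.

Lemma jetL_jetL a c v :
  jetL a (jetL c v) - jetL c (jetL a v) = jetL (cont_br00 a c) v.
Proof.
apply: jetP; [jet_ring|jet_ring|by rewrite /= subrr].
Qed.

(** To [ring] the constant [h] is a variable, so identities that rest on h + h = 1 are stated up to
    an explicit multiple of h + h - 1. *)
Lemma add_half (x y z : cinf) : x = y + (h + h - 1) * z -> x = y.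
Proof. by rewrite hh subrr mul0r addr0. Qed.

Lemma jetL_jetM a b v :
  jetL a (jetM b v) - jetM b (jetL a v) = jetM (cont_br01 a b) v.
Proof.
apply: jetP; [jet_ring| |by rewrite /= subrr].
by apply: (@add_half _ _ (D a * b * (D v.1.1 + C v.2))); jet_ring.
Qed.

Lemma jetM_jetM b c v :
  jetM b (jetM c v) + jetM c (jetM b v) = jetL (cont_br11 b c) v.
Proof.
rewrite /cont_br11 mulr2n; apply: jetP; [jet_ring| |by rewrite /= addr0].
by apply: (@add_half _ _ (D (b * c) * v.1.2)); jet_ring.
Qed.

Local Notation act := (@act_env R[i] g jet jetL jetM).

Lemma jet_act_add : forall u w v, act (u + w) v = act u v + act w v.
Proof.
exact: (@act_envD R[i] g jet jetL jetM jetL_linear jetM_linear jetL_linearl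
  jetM_linearl
  jetL_jetL jetL_jetM jetM_jetM).
Qed.

Lemma jet_act_mul : forall u w v, act (u * w) v = act u (act w v).
Proof.
exact: (@act_envM R[i] g jet jetL jetM jetL_linear jetM_linear jetL_linearl
  jetM_linearl
  jetL_jetL jetL_jetM jetM_jetM).
Qed.

Lemma jet_act_one : forall v, act 1 v = v.
Proof.
exact: (@act_env1 R[i] g jet jetL jetM jetL_linear jetM_linear jetL_linearl
  jetM_linearl
  jetL_jetL jetL_jetM jetM_jetM).
Qed.

Lemma jet_act_ienv0 a v : act (ienv0 (a : lie0 g)) v = jetL a v.
Proof.
exact: (@act_ienv0 R[i] g jet jetL jetM jetL_linear jetM_linear jetL_linearl
  jetM_linearl
  jetL_jetL jetL_jetM jetM_jetM).
Qed.

Lemma jet_act_ienv1 b v : act (ienv1 (b : lie1 g)) v = jetM b v.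
Proof.
exact: (@act_ienv1 R[i] g jet jetL jetM jetL_linear jetM_linear jetL_linearl
  jetM_linearl
  jetL_jetL jetL_jetM jetM_jetM).
Qed.

Definition jet_even v (u : env) : cinf := (act u v).1.1.
Definition jet_odd v (u : env) : cinf := (act u v).1.2.
Definition jet_phi v (u : env) : cinf := C (act u v).2.

Lemma jet_evenD v : {morph jet_even v : u w / u + w}.
Proof. by move=> u w; rewrite /jet_even jet_act_add. Qed.
Lemma jet_oddD v : {morph jet_odd v : u w / u + w}.
Proof. by move=> u w; rewrite /jet_odd jet_act_add. Qed.
Lemma jet_phiD v : {morph jet_phi v : u w / u + w}.
Proof. by move=> u w; rewrite /jet_phi jet_act_add; apply: scalerDl. Qed.

Definition orbit_map v (x : grassmann env) : sfun :=
  (gmap (jet_even v) x, gmap (jet_odd v) x).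
Definition orbit_phi v (x : grassmann env) : coef := gmap (jet_phi v) x.

Definition env_gen I a : env := if odd #|` I| then ienv1 (a :
  lie1 g) else ienv0 (a : lie0 g).
Definition grp_gen I a : grassmann env := 1 + gmon I (env_gen I a).

Lemma gmap_deriv (f : env -> cinf) x : {morph f : u w / u + w} ->
  gmap (fun u => D (f u)) x = d (gmap f x).
Proof.
move=> fD; have DfD : {morph (fun u => D (f u)) : u w / u + w}.
  by move=> u w; rewrite fD cderivD.
elim/grassmann_ind: x => [|x y hx hy|J u].
- by rewrite !gmap0; exact/esym/gmap0.
- apply: etrans (gmapD DfD x y) _; apply: etrans (congr2 +%R hx hy) _.
  by apply: esym; rewrite (gmapD fD); apply: gderivD.
by rewrite (gmap_mon DfD) (gmap_mon fD) gderiv_mon.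
Qed.

Lemma grp_genM (f : env -> cinf) I a y : {morph f : u w / u + w} ->
  gmap f (grp_gen I a * y) = gmap f y + gmap f (gmon I (env_gen I a) * y).
Proof.
move=> fD; apply: etrans (congr1 (gmap f) (mulrDl _ _ _)) _.
by rewrite mul1r; apply: gmapD.
Qed.

(** The generator acts on the superfunction part by [gen_op]; the extra term is its action on the
    multiple of phi contained in y v. *)
Lemma orbit_gen v I a y : orbit_map v (grp_gen I a * y) =
  gen_op I a (orbit_map v y) +
  (if odd #|` I| then (0, gmon I a * orbit_phi v y) else (gmon I a * orbit_phi v
    y, 0)).
Proof.
have DeD : {morph (fun u => D (jet_even v u)) : u w / u + w}.
  by move=> u w; rewrite jet_evenD cderivD.
have DoD : {morph (fun u => D (jet_odd v u)) : u w / u + w}.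
  by move=> u w; rewrite jet_oddD cderivD.
have eD := jet_evenD v; have oD := jet_oddD v; have pD := jet_phiD v.
rewrite /orbit_map !grp_genM // /env_gen /gen_op.
case: (boolP (odd _)) => oI.
  rewrite (@gmap_gmonM _ _ _ (jet_odd v) (jet_odd v) _ (- a) 0) //; last first.
    move=> u; rewrite /jet_even jet_act_mul jet_act_ienv1 /= addr0 mul0r addr0.
    by rewrite mulNr.
  rewrite (@gmap_gmonM _ _ _ (fun u => D (jet_even v u)) (jet_phi v) _ a a) //;
    last first.
    move=> u; rewrite /jet_odd jet_act_mul jet_act_ienv1 /= ZE; congr (_ + _).
    exact: mulrC.
  rewrite gmap_deriv // gmon0 mul0r addr0 /gmon monalgUN.
  apply: sfP => /=; first by rewrite addr0 mulNr.
  exact: addrA.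
rewrite (@gmap_gmonM _ _ _ (fun u => D (jet_even v u)) (jet_phi v) _ a a) //;
  last first.
  move=> u; rewrite /jet_even jet_act_mul jet_act_ienv0 /= ZE; congr (_ + _).
  exact: mulrC.
rewrite (@gmap_gmonM _ _ _ (fun u => D (jet_odd v u)) (jet_odd v) _ a (half *:
  D a)) //; last first.
  move=> u; rewrite /jet_odd jet_act_mul jet_act_ienv0 /= addr0; congr (_ + _).
  by rewrite scalerAl.
rewrite !gmap_deriv //; apply: sfP => /=.
  by rewrite /dens mul0r addr0 addrA.
by rewrite addr0 /dens addrA.
Qed.

Lemma orbit_phi_gen v I a y : orbit_phi v (grp_gen I a * y) = orbit_phi v y.
Proof.
have pD := jet_phiD v; rewrite /orbit_phi grp_genM //.
rewrite (@gmap_gmonM _ _ _ (jet_phi v) (jet_phi v) _ 0 0) //.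
  by rewrite gmon0 !mul0r !addr0.
move=> u; rewrite /jet_phi jet_act_mul /env_gen !mul0r addr0.
by case: (odd _); rewrite ?jet_act_ienv0 ?jet_act_ienv1 /= C0.
Qed.

Definition jet_of_phi : jet := ((0, 0), 1).
Definition jet_of_theta : jet := ((0, 1), 0).

(** [orbit_map] leaves out the multiple of phi, which is 1 in x phi on the group, so that the first
    field is the increment and not the image of phi. *)
Definition Phi (x : grassmann env) : substitution R :=
  Substitution (orbit_map jet_of_phi x) (orbit_map jet_of_theta x).

(* x phi is phi plus a function, and x theta is a function.                    *)
Definition phi_normal (x : grassmann env) : Prop :=
  orbit_phi jet_of_phi x = 1 /\ orbit_phi jet_of_theta x = 0.

Lemma phi_normal1 : phi_normal 1.
Proof.
split; rewrite /orbit_phi -[1]/(gmon fset0 1).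
  by rewrite (gmap_mon (jet_phiD _)) /jet_phi jet_act_one /C scale1r.
by rewrite (gmap_mon (jet_phiD _)) /jet_phi jet_act_one C0 gmon0.
Qed.

Lemma phi_normal_gen I a y : phi_normal y -> phi_normal (grp_gen I a * y).
Proof. by move=> [y1 y0]; split; rewrite orbit_phi_gen. Qed.

Lemma Phi1 : Phi 1 = Substitution 0 th.
Proof.
have m1 (f : env -> cinf) : {morph f : u w / u + w} ->
    gmap f (1 : grassmann env) = gmon fset0 (f 1) :> coef.
  by move=> fD; rewrite -[1]/(gmon fset0 1) (gmap_mon fD).
rewrite /Phi /orbit_map !m1; try exact: jet_evenD; try exact: jet_oddD.
by rewrite /jet_even /jet_odd !jet_act_one /= gmon0.
Qed.

Lemma Phi_gen I a y : phi_normal y -> Phi (grp_gen I a * y) = gen_comp I a (Phi y).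
Proof.
move=> [y1 y0]; rewrite /Phi /gen_comp !orbit_gen y1 y0 mulr1 mulr0 /=.
congr Substitution; first by rewrite addrC /gen_incr; case: (odd _).
by case: (odd _); apply: addr0.
Qed.

End NaturalMap.

(** * The surplace group *)

(** The commutator of 1 + p and 1 + q is 1 + r as soon as p and q kill r from the left. *)
Lemma unipotent_swap (A : pzRingType) (p q r : A) :
  q * r = 0 -> p * r = 0 -> p * q = q * p + r ->
  (1 + p) * (1 + q) = (1 + q) * ((1 + p) * (1 + r)).
Proof.
move=> qr pr pq; have pr1 : (1 + p) * (1 + r) = 1 + p + r.
  by rewrite mulrDr mulr1 mulrDl mul1r pr addr0.
rewrite pr1 !mulrDl !mulrDr !mul1r !mulr1 qr addr0 pq !addrA.
by rewrite (ACl (1*3*5*2*4)).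
Qed.

Lemma unipotent_add (A : pzRingType) (p q : A) :
  p * q = 0 -> (1 + p) * (1 + q) = 1 + (p + q).
Proof. by move=> pq; rewrite mulrDr mulr1 mulrDl mul1r pq addr0 addrA. Qed.

Lemma mul_swap (A : pzRingType) (u v w y : A) :
  u * v = v * (u * w) -> u * (v * y) = v * (u * (w * y)).
Proof. by move=> uv; rewrite mulrA uv !mulrA. Qed.

Lemma gmon_supercomm (S : pzRingType) (I J : {fset nat}) (u v w : S) :
  [disjoint J & I]%fset -> u * v = (-1) ^+ (#|` J| * #|` I|) * (v * u) + w ->
  gmon J u * gmon I v =
  gmon I v * gmon J u + gmon (J `|` I)%fset ((-1) ^+ ninv J I * w).
Proof.
move=> dJI uv; have dIJ : [disjoint I & J]%fset by rewrite fdisjoint_sym.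
rewrite (gmonM J I) (gmonM I J) /gmulU dJI dIJ fsetUC uv -gmonD; congr gmon.
rewrite mulrDr mulrA -exprD; congr (_ * _ + _).
rewrite -(ninv_sym dJI) addnA addnn -mul2n exprD exprM.
by rewrite sqrrN !expr1n mul1r.
Qed.

Section SurplaceGroup.
Variable R : realType.
Local Notation cinf := (cinf R).
Local Notation coef := (grassmann cinf).
Local Notation sfun := (superfun coef).
Local Notation g := (cont R).
Local Notation env := (env g).
Local Notation env_gen := (@env_gen R).
Local Notation grp_gen := (@grp_gen R).
Implicit Types (I J : {fset nat}) (a b f : cinf) (x y z : grassmann env).
Implicit Types (T : substitution R) (F : sfun).

(** Products alone give a group for k > 0, as the inverse of a generator is the one with the
    opposite parameter. The bound k allows induction on the least code. *)
Inductive gens_from k : grassmann env -> Prop :=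
| gens1 : gens_from k 1
| gensM I a x : (k <= fcode I)%N -> gens_from k x -> gens_from k (grp_gen I a * x).

Lemma gens_mul k x y : gens_from k x -> gens_from k y -> gens_from k (x * y).
Proof.
move=> gx gy; elim: gx => [|I a {}x kI gx ih]; first by rewrite mul1r.
by rewrite -mulrA; apply: gensM.
Qed.

Lemma gens_gen k I a : (k <= fcode I)%N -> gens_from k (grp_gen I a).
Proof. by move=> kI; rewrite -[grp_gen I a]mulr1; apply: gensM kI (gens1 k). Qed.

Lemma env_genD I : {morph env_gen I : a b / a + b}.
Proof.
move=> a b; rewrite /env_gen; case: (odd _).
  by have := ienv1_linear (1 : R[i]) (a : lie1 g) b; rewrite !scale1r.
by have := ienv0_linear (1 : R[i]) (a : lie0 g) b; rewrite !scale1r.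
Qed.

Lemma env_gen0 I : env_gen I (0 : cinf) = 0.
Proof. by apply: (addrI (env_gen I (0 : cinf))); rewrite -env_genD !addr0. Qed.

Lemma env_genN I a : env_gen I (- a) = - env_gen I a.
Proof. by apply/eqP; rewrite -addr_eq0 -env_genD addNr env_gen0. Qed.

Lemma env_gen_sign I n a : env_gen I ((-1) ^+ n * a) = (-1) ^+ n * env_gen I a.
Proof.
rewrite -signr_odd -[in RHS]signr_odd; case: (odd n); rewrite ?mul1r //.
by rewrite !expr1 !mulN1r env_genN.
Qed.

Lemma grp_gen0 I : grp_gen I (0 : cinf) = 1.
Proof. by rewrite /grp_gen env_gen0 gmon0 addr0. Qed.

Lemma code_neq0 k I : (k.+1 <= fcode I)%N -> I != fset0.
Proof. by move=> kI; rewrite -fcode_eq0 -lt0n; apply: leq_trans kI. Qed.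

Lemma grp_genD I a b : I != fset0 -> grp_gen I a * grp_gen I b = grp_gen I (a + b).
Proof.
move=> I0; rewrite /grp_gen env_genD gmonD.
have := gmon_sandwich (env_gen I a) (env_gen I b) 1 I0; rewrite mulr1.
exact: unipotent_add.
Qed.

Lemma gens_inv k x : (0 < k)%N -> gens_from k x ->
  exists y, [/\ gens_from k y, x * y = 1 & y * x = 1].
Proof.
move=> k0; elim=> [|I a {}x kI gx [y [gy xy yx]]].
  by exists 1; split; rewrite ?mulr1 //; apply: gens1.
have I0 : I != fset0 by apply: (@code_neq0 0); apply: leq_trans kI.
have gN : grp_gen I a * grp_gen I (- a) = 1 by rewrite grp_genD // subrr grp_gen0.
have Ng : grp_gen I (- a) * grp_gen I a = 1 by rewrite grp_genD // addNr grp_gen0.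
exists (y * grp_gen I (- a)); split.
- by apply: gens_mul => //; apply: gens_gen.
- by rewrite -mulrA (mulrA x) xy mul1r gN.
- by rewrite -mulrA (mulrA _ (grp_gen I a)) Ng mul1r.
Qed.

(** The parity of an index is that of its Lie element, so the sign from exchanging a_J and a_I is
    the one in the superbracket, and the bracket has the parity of the disjoint union. *)
Lemma env_gen_comm I J a b : [disjoint J & I]%fset -> exists c : cinf,
  env_gen J b * env_gen I a =
  (-1) ^+ (#|` J| * #|` I|) * (env_gen I a * env_gen J b) + env_gen (J `|`
    I)%fset c.
Proof.
move=> dJI; rewrite /env_gen card_fsetU_disj // -signr_odd oddM oddD.
case: (odd #|` J|); case: (odd #|` I|) => /=.
- exists (cont_br11 b a).
  exact: etrans (ienv_br11 (b : lie1 g) a) (congr1 (fun w => w + _) (esym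
    (mulN1r _))).
- exists (- cont_br01 a b).
  exact: etrans (ienv_br10 (b : lie1 g) a) (congr1 (fun w => w + _) (esym (mul1r
    _))).
- exists (cont_br01 b a).
  exact: etrans (ienv_br01 (b : lie0 g) a) (congr1 (fun w => w + _) (esym (mul1r
    _))).
exists (cont_br00 b a).
exact: etrans (ienv_br00 (b : lie0 g) a) (congr1 (fun w => w + _) (esym (mul1r _))).
Qed.

(** If I and J meet, both products of the nilpotent parts vanish and the generators commute.
    Otherwise their commutator is a generator whose index is the union, of code larger than that of
    I. *)
Lemma grp_gen_swap I J a b : I != fset0 -> J != fset0 -> exists2 z,
  gens_from (fcode I).+1 z &
  grp_gen J b * grp_gen I a = grp_gen I a * (grp_gen J b * z).
Proof.
move=> I0 J0; case: (boolP [disjoint J & I]%fset) => dJI; last first.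
  exists 1; first exact: gens1.
  have pq : gmon J (env_gen J b) * gmon I (env_gen I a) = 0.
    by rewrite gmonM /gmulU (negbTE dJI).
  have qp : gmon I (env_gen I a) * gmon J (env_gen J b) = 0.
    by rewrite gmonM /gmulU fdisjoint_sym (negbTE dJI).
  have := unipotent_swap (mulr0 _) (mulr0 _) (etrans pq (esym (etrans (addr0 _)
    qp))).
  by rewrite addr0.
have [c cE] := env_gen_comm a b dJI.
exists (grp_gen (J `|` I)%fset ((-1) ^+ ninv J I * c)).
  apply: gens_gen; rewrite fcodeU // -addn1 addnC leq_add2r.
  by rewrite lt0n fcode_eq0.
rewrite /grp_gen; apply: unipotent_swap.
- rewrite gmonM /gmulU fdisjointXU.
  case: ifP => // /andP[_ /eqP]; rewrite fsetIid => /eqP.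
  by rewrite (negbTE I0).
- rewrite gmonM /gmulU fdisjointXU.
  case: ifP => // /andP[/eqP]; rewrite fsetIid => /eqP.
  by rewrite (negbTE J0).
exact: etrans (gmon_supercomm dJI cE)
  (congr1 (fun t => _ + gmon _ t) (esym (env_gen_sign _ _ _))).
Qed.

(** Generators of code k all have the index I, as codes are injective. They are moved to the front,
    where they merge into one by adding parameters; each move creates only factors of larger
    code. *)
Lemma gens_collect k I x : (0 < k)%N -> fcode I = k -> gens_from k x ->
  exists a, exists2 y, gens_from k.+1 y & x = grp_gen I a * y.
Proof.
move=> k0 Ik; elim=> [|J b {}x kJ gx [a [y gy ->]]].
  by exists 0, 1; [apply: gens1|rewrite grp_gen0 mulr1].
have I0 : I != fset0 by rewrite -fcode_eq0 Ik -lt0n.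
have J0 : J != fset0 by rewrite -fcode_eq0 -lt0n; apply: leq_trans kJ.
case: (eqVneq J I) => [->|JI].
  exists (b + a), y; first exact: gy.
  exact: etrans (mulrA _ _ _) (congr1 (fun t => t * y) (grp_genD b a I0)).
have [z gz e] := grp_gen_swap a b I0 J0.
exists a, (grp_gen J b * (z * y)); last exact: mul_swap e.
apply: gensM; first by rewrite ltn_neqAle kJ andbT -Ik eq_sym (inj_eq fcode_inj).
by rewrite -Ik in gy *; apply: gens_mul gz gy.
Qed.
End SurplaceGroup.

(** * Bijectivity *)

Section Bijectivity.
Variable R : realType.
Local Notation cinf := (cinf R).
Local Notation coef := (grassmann cinf).
Local Notation sfun := (superfun coef).
Local Notation D := (@cderiv R).
Local Notation th := (sf_theta cinf).
Local Notation g := (cont R).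
Local Notation env := (env g).
Local Notation env_gen := (@env_gen R).
Local Notation grp_gen := (@grp_gen R).
Implicit Types (I J : {fset nat}) (a b f : cinf) (x y z : grassmann env).
Implicit Types (T : substitution R) (F : sfun).

Local Notation Phi := (@Phi R).
Local Notation gens_from := (@gens_from R).

Lemma gens_supp k x : gens_from k x -> gsupp (code_ge k) (x - 1).
Proof.
elim=> [|I a {}x kI gx ih]; first by rewrite subrr; apply: gsupp0.
have -> : grp_gen I a * x - 1 = (x - 1) + gmon I (env_gen I a) * x.
  exact: etrans (congr1 (fun t => t - 1) (mulrDl _ _ _))
    (etrans (congr1 (fun t => t + _ - 1) (mul1r _)) (addrAC _ _ _)).
apply: gsuppD ih _; rewrite -[k]addn0; apply: gsuppM_code; last exact: gsupp_code0.
exact: gsupp_mon.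
Qed.

Lemma gens_normal k x : gens_from k x -> phi_normal x.
Proof.
elim=> [|I a {}x _ _ ih]; first exact: phi_normal1.
exact: phi_normal_gen.
Qed.

Lemma contact_data1 : contact_data (Substitution 0 th : substitution R).
Proof.
have s0 P : @sf_supp cinf P 0 by split; apply: gsupp0.
split=> /=; first by split; apply: gsupp0.
- by split; [apply: gsupp0|apply: gsupp_even1].
- by split; rewrite /= ?subrr; apply: s0.
split=> /=; first by rewrite mulr0 addr0.
rewrite mulr1 mulr0 addr0 (_ : gderiv 0 = 0) ?addr0 //.
exact: gmap0.
Qed.

Lemma gens_contact k x : (0 < k)%N -> gens_from k x -> contact_data (Phi x).
Proof.
move=> k0; elim=> [|I a {}x kI gx ih]; first by rewrite Phi1; apply: contact_data1.
rewrite Phi_gen; last exact: gens_normal gx.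
by apply: gen_comp_contact ih; apply: (@code_neq0 0); apply: leq_trans kI.
Qed.

Lemma subst_id F : subst (Substitution 0 th) F = F.
Proof.
have t0 f : taylor f (0 : sfun) = sf_scal f.
  by rewrite taylor_sqr0 ?expr2 ?mulr0 // addr0.
move: F; apply: sf_additive_ext => [||f J|f J] //; first exact: substD.
  by rewrite subst_const t0.
by rewrite subst_theta_const t0.
Qed.

Lemma sub_comp_id T : sub_comp (Substitution 0 th) T = T.
Proof.
case: T => W Th; rewrite /sub_comp; congr Substitution; last exact: subst_id.
exact: etrans (add0r _) (subst_id W).
Qed.

(** Substituting by the composite is substituting by T and then applying [gen_op], which is
    additive; the rest is associativity of the sum of increments. *)
Lemma gen_comp_assoc I a T T' : I != fset0 -> contact_data T ->
  gen_comp I a (sub_comp T T') = sub_comp (gen_comp I a T) T'.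
Proof.
move=> I0 cT; have [_ _ [g1 _] _] := gen_comp_contact a I0 cT.
have [eW _ [W1 _] _] := cT.
have E F : subst (gen_comp I a T) F = gen_op I a (subst T F).
  by rewrite -(gen_compE a I0); apply: subst_gen_comp.
apply: (congr2 (@Substitution R)); last exact: esym (E _).
apply: etrans (congr1 (fun F => _ + F) (gen_opD I a _ _)) _.
apply: etrans (addrA _ _ _) _.
exact: (congr1 (fun F => _ + F) (esym (E _))).
Qed.

Lemma Phi_hom x y : gens_from 1 x -> gens_from 1 y ->
  Phi (x * y) = sub_comp (Phi x) (Phi y).
Proof.
move=> gx gy; elim: gx => [|I a {}x kI gx ih].
  by rewrite Phi1 sub_comp_id; apply: (congr1 Phi (mul1r y)).
have I0 := code_neq0 kI; have cx := gens_contact (ltn0Sn 0) gx.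
apply: etrans (congr1 Phi (esym (mulrA _ x y))) _.
apply: etrans (Phi_gen I a (gens_normal (gens_mul gx gy))) _.
rewrite ih (Phi_gen I a (gens_normal gx)).
exact: gen_comp_assoc.
Qed.

(** All terms of y - 1 have code above k, so only a_I itself contributes at I. *)
Lemma gens_coef k I a y : (0 < k)%N -> fcode I = k -> gens_from k.+1 y ->
  (grp_gen I a * y)@_I = env_gen I a.
Proof.
move=> k0 Ik gy; have y1 := gens_supp gy.
have I0 : I != fset0 by rewrite -fcode_eq0 Ik -lt0n.
have -> : grp_gen I a * y =
    1 + gmon I (env_gen I a) + (y - 1 + gmon I (env_gen I a) * (y - 1)).
  rewrite /grp_gen; move: (gmon I _) => p.
  by rewrite -{1}(subrK 1 y) mulrDr mulr1 mulrDl mul1r addrC.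
have c0 : (gmon I (env_gen I a) * (y - 1))@_I = 0.
  apply: (@gsupp_coef0 _ (k + k.+1)); last by lia.
  apply: gsuppM_code y1; apply: gsupp_mon.
  by rewrite /code_ge Ik.
rewrite 3!mcoeffD c0 (gsupp_coef0 y1) ?Ik // !addr0 mcoeffUU.
by rewrite [(1 : grassmann env)@_I]mcoeffU eq_sym (negbTE I0) add0r.
Qed.

(** The coefficient of x at I is the Lie element of its first generator. It kills phi when the image
    of x is trivial, and its value on phi is its parameter a, or a theta, so a = 0. *)
Lemma kernel_step k x : (0 < k)%N -> gens_from k x -> Phi x = Substitution 0 th ->
  gens_from k.+1 x.
Proof.
move=> k0 gx Px; case: (pselect (exists I, fcode I = k)) => [[I Ik]|nI]; last first.
  (* When no index has code k, every code is already at least k+1. *)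
  elim: gx {Px} => [|I a {}x kI gx ih]; first exact: gens1.
  apply: gensM => //; rewrite ltn_neqAle kI andbT.
  by apply/eqP => e; apply: nI; exists I.
have [a [y gy xE]] := gens_collect k0 Ik gx.
have xI := gens_coef a k0 Ik gy; rewrite -xE in xI.
have W0 : sub_incr (Phi x) = 0 by rewrite Px.
have W1 : jet_even (jet_of_phi R) x@_I = 0.
  by rewrite -(gmapE (jet_evenD _)) -[gmap _ _]/((sub_incr (Phi x)).1) W0 mcoeff0.
have W2 : jet_odd (jet_of_phi R) x@_I = 0.
  by rewrite -(gmapE (jet_oddD _)) -[gmap _ _]/((sub_incr (Phi x)).2) W0 mcoeff0.
have D0 : D 0 = 0 := morphD0 (@cderivD R).
suff a0 : a = 0 by rewrite xE a0 grp_gen0 mul1r.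
move: W1 W2; rewrite xI /jet_even /jet_odd /env_gen; case: (odd _) => W1 W2.
  move: W2; rewrite (jet_act_ienv1 a (jet_of_phi R)) /= D0 mulr0 add0r.
  by rewrite scale1r.
move: W1; rewrite (jet_act_ienv0 a (jet_of_phi R)) /= D0 mulr0 add0r.
by rewrite scale1r.
Qed.

Lemma kernel_trivial x : gens_from 1 x -> Phi x = Substitution 0 th -> x = 1.
Proof.
move=> gx Px; apply/eqP; rewrite -subr_eq0; apply/eqP/gsupp_code_all => k.
apply: (@gsupp_code_le _ k.+1) => //; apply: gens_supp.
elim: k => [|k ih]; first exact: gx.
exact: kernel_step (ltn0Sn k) ih Px.
Qed.
End Bijectivity.

(** * Surjectivity and the conclusion *)

Section Surjectivity.
Variable R : realType.
Local Notation cinf := (cinf R).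
Local Notation coef := (grassmann cinf).
Local Notation sfun := (superfun coef).
Local Notation D := (@cderiv R).
Local Notation th := (sf_theta cinf).
Local Notation g := (cont R).
Local Notation env := (env g).
Local Notation env_gen := (@env_gen R).
Local Notation grp_gen := (@grp_gen R).
Implicit Types (I J : {fset nat}) (a b f : cinf) (x y z : grassmann env).
Implicit Types (T : substitution R) (F : sfun).

Local Notation Phi := (@Phi R).
Local Notation gens_from := (@gens_from R).

Lemma mono_env_gen (s : R[i]) I a :
  mono s I (if odd #|` I| then ienv1 (a : lie1 g) else ienv0 (a : lie0 g)) =
  gmon I (env_gen I (s *: a)).
Proof.
rewrite /mono /env_gen; congr gmon; case: (odd _).
  have := ienv1_linear s (a : lie1 g) 0.
  (* At a set of odd size [env_gen] is [ienv1]; a singleton serves here, and the empty set serves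
     for [ienv0] below. *)
  have -> : ienv1 (0 : lie1 g) = 0 by have := env_gen0 R [fset 0%N]%fset;
    rewrite /env_gen cardfs1.
  by rewrite !addr0 => <-.
have := ienv0_linear s (a : lie0 g) 0.
have -> : ienv0 (0 : lie0 g) = 0 by have := env_gen0 R fset0;
  rewrite /env_gen cardfs0.
by rewrite !addr0 => <-.
Qed.

Lemma mono_ienv0 (s : R[i]) I a : ~~ odd #|` I| ->
  1 + mono s I (ienv0 (a : lie0 g)) = grp_gen I (s *: a).
Proof. by move=> oI; have := mono_env_gen s I a; rewrite (negbTE oI) => ->. Qed.

Lemma mono_ienv1 (s : R[i]) I a : odd #|` I| ->
  1 + mono s I (ienv1 (a : lie1 g)) = grp_gen I (s *: a).
Proof. by move=> oI; have := mono_env_gen s I a; rewrite oI => ->. Qed.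

Lemma odd_set_neq0 I : odd #|` I| -> I != fset0.
Proof. by apply: contraTneq => ->; rewrite cardfs0. Qed.

Lemma gens_subgroup : is_subgroup (gens_from 1).
Proof.
split.
- by move=> x /(gens_inv (ltn0Sn 0)) [y [_ xy yx]]; exists y.
- exact: gens1.
- by move=> x y; apply: gens_mul.
move=> x y /(gens_inv (ltn0Sn 0)) [z [gz xz zx]] xy yx.
by have -> : y = z by rewrite -[y]mul1r -zx -mulrA xy mulr1.
Qed.

Lemma grp_gen_ContV I a : I != fset0 -> ContV (grp_gen I a).
Proof.
move=> I0 H [_]; apply; case: (boolP (odd #|` I|)) => oI.
  right; exists 1, I, (a : lie1 g); split; first exact: oI.
  by rewrite (mono_ienv1 1 a oI) scale1r.
left; exists 1, I, (a : lie0 g); split; [exact: oI|by rewrite cardfs_gt0|].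
by rewrite (mono_ienv0 1 a oI) scale1r.
Qed.

Lemma ContVE x : ContV x <-> gens_from 1 x.
Proof.
split=> [|gx].
  (* Membership in the smallest subgroup is applied to [gens_from 1], a subgroup that contains the
     generators. *)
  apply; split; first exact: gens_subgroup.
  move=> _ [[s [I [a [oI I0 ->]]]]|[s [I [a [oI ->]]]]].
    rewrite mono_ienv0 //; apply: gens_gen.
    by rewrite lt0n fcode_eq0 -cardfs_gt0.
  rewrite mono_ienv1 //; apply: gens_gen.
  by rewrite lt0n fcode_eq0 odd_set_neq0.
elim: gx => [|I a {}x kI gx ih] H sH; have [[_ H1 HM _] _] := sH; first exact: H1.
apply: HM; last exact: ih.
by apply: grp_gen_ContV => //; apply: code_neq0 kI.
Qed.

Lemma Phi_grp_gen I a : I != fset0 -> Phi (grp_gen I a) = gen_subst I a.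
Proof.
move=> I0; have e : grp_gen I a = grp_gen I a * 1 by exact: esym (mulr1 _).
rewrite e (Phi_gen I a (phi_normal1 R)) Phi1 -(gen_compE a I0) /sub_comp.
apply: (congr2 (@Substitution R)); rewrite !(subst_gen _ I0).
  have -> : gen_op I a 0 = 0.
    by apply: (addrI (gen_op I a 0)); rewrite -(gen_opD I a) !addr0.
  exact: addr0.
exact: gen_op_theta.
Qed.

Lemma gen_comp0 I T : gen_comp I (0 : cinf) T = T.
Proof.
have D0 : D 0 = 0 := morphD0 (@cderivD R).
have op0 F : gen_op I 0 F = F.
  apply: sfP; rewrite /gen_op D0 scaler0 gmon0; case: (odd _) => /=.
  - by rewrite mul0r subr0.
  - by rewrite /dens !mul0r !addr0.
  - by rewrite mul0r addr0.
  by rewrite /dens !mul0r !addr0.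
case: T => W Th; rewrite /gen_comp /= !op0; congr Substitution.
by rewrite /gen_incr gmon0; case: (odd _); apply: add0r.
Qed.

Lemma sub_supp_id n k T : (2 ^ n <= k)%N -> sub_supp (in_gens n) T ->
  sub_supp (code_ge k) T -> T = Substitution 0 th.
Proof.
case: T => W Th nk [[/= Wn1 Wn2] [Tn1 Tn2]] [[/= Wk1 Wk2] [Tk1 Tk2]].
apply: (congr2 (@Substitution R)).
  by apply: sfP; apply: gsupp_in_code; eassumption.
apply/eqP; rewrite -subr_eq0; apply/eqP.
by apply: sfP; apply: gsupp_in_code; eassumption.
Qed.

Lemma in_gensU n I J : [disjoint I & J]%fset -> in_gens n I -> in_gens n J ->
  in_gens n (I `|` J)%fset.
Proof. by move=> _ In Jn i; rewrite inE => /orP[/In|/Jn]. Qed.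

(** Here m bounds the number of codes from k on that are still possible in the first n of the a_j.
    Each round removes the coefficients of code k; when m = 0 nothing but the identity is left. *)
Lemma Phi_surj n m k T : (0 < k)%N -> contact_data T -> sub_supp (code_ge k) T ->
  sub_supp (in_gens n) T -> (2 ^ n <= k + m)%N ->
  exists2 x, gens_from 1 x & Phi x = T.
Proof.
elim: m k T => [|m ih] k T k0 cT Tk Tn nk.
  exists 1; first exact: gens1.
  by rewrite Phi1 (sub_supp_id _ Tn Tk) // -[k]addn0.
have nk' : (2 ^ n <= k.+1 + m)%N by rewrite addSnnS.
case: (pselect (exists I, fcode I = k)) => [[I Ik]|nI]; last first.
  apply: (ih k.+1) => //; have up F : sf_supp (code_ge k) F ->
    sf_supp (code_ge k.+1) F.
    move=> [F1 F2]; split; [apply: gsuppW F1|apply: gsuppW F2] => J kJ;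
      rewrite /code_ge ltn_neqAle kJ andbT; apply/eqP => e; apply: nI; by exists J.
  by case: Tk => /up ? /up ?; split.
have I0 : I != fset0 by rewrite -fcode_eq0 Ik -lt0n.
have step := leading_step k0 cT Tk Ik.
(* A nonzero coefficient shows that I lies among the first n indices, so that composing with the
   generator brings in no new a_j. *)
case: (eqVneq (leading_coef T I) 0) => [a0|a0].
  move: step; rewrite a0 oppr0 gen_comp0 => step.
  exact: (ih k.+1 T (ltn0Sn k) cT step Tn nk').
have In : in_gens n I.
  move: a0; rewrite /leading_coef; have [[W1 W2] _] := Tn.
  by case: (odd _) => [/W2|/W1].
have [//||||x gx Px] := ih k.+1 (gen_comp I (- leading_coef T I) T) _ _ _ _ nk'.
- exact: gen_comp_contact.
- exact: step.
- by apply: gen_comp_supp => // J dIJ; apply: in_gensU.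
exists (grp_gen I (leading_coef T I) * x); first by apply: gensM => //; rewrite Ik.
by rewrite (Phi_gen _ _ (gens_normal gx)) Px gen_compNK.
Qed.
End Surjectivity.

Theorem theorem3p4 (R : realType) :
  exists Phi : grassmann (env (cont R)) -> substitution R,
    natural_hom Phi /\ set_bij (@ContV R) (@SCont R) Phi.
Proof.
exists (@Phi R); split.
  split=> [x y /ContVE gx /ContVE gy|s I a oI I0|s I b oI].
  - exact: Phi_hom.
  - rewrite mono_ienv0 // Phi_grp_gen -?cardfs_gt0 //.
    rewrite /gen_subst /gen_incr /gen_theta (negbTE oI) /subL /mono.
    by rewrite cderivZ !scalerA mulrC.
  rewrite mono_ienv1 // Phi_grp_gen ?odd_set_neq0 //.
  by rewrite /gen_subst /gen_incr /gen_theta oI.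
split.
- by move=> x /ContVE gx; apply/SContE; apply: gens_contact gx.
- move=> x y; rewrite !inE => /ContVE gx /ContVE gy e.
  have [z [gz xz zx]] := gens_inv (ltn0Sn 0) gx.
  (* With z the inverse of x, the product z y has the same image as z x = 1, so it lies in the
     trivial kernel. *)
  have zy : z * y = 1.
    apply: kernel_trivial; first exact: gens_mul.
    apply: etrans (Phi_hom gz gy) _; rewrite -e.
    exact: etrans (esym (Phi_hom gz gx)) (etrans (congr1 (@Phi R) zx) (Phi1 R)).
  by rewrite -[x]mulr1 -{1}zy mulrA xz mul1r.
move=> T /SContE cT; have [_ _ T1 _] := cT.
have [n Tn] : exists n, sub_supp (in_gens n) T.
  have [n1 [a1 a2]] := sf_in_ex (sub_incr T).
  have [n2 [b1 b2]] := sf_in_ex (sub_theta T - sf_theta (cinf R)).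
  exists (maxn n1 n2); split; split.
  - exact: gsupp_in_le (leq_maxl _ _) a1.
  - exact: gsupp_in_le (leq_maxl _ _) a2.
  - exact: gsupp_in_le (leq_maxr _ _) b1.
  exact: gsupp_in_le (leq_maxr _ _) b2.
have [//|x gx Px] := @Phi_surj R n (2 ^ n) 1 T _ cT T1 Tn (leq_addl _ _).
by exists x => //; apply/ContVE.
Qed.
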